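(* There exist universal constants $C, C' > 0$ such that the following holds. Let $N, n, d \ge 1$ be integers and let $\{Y_i\}_{i=1}^{\infty}$ be a stationary reversible Markov chain with state space $[N]$, transition matrix $A$, stationary probability measure $\mu$ (so that $Y_1$ is distributed according to $\mu$) and averaging operator $E_\mu$, and let $\lambda = \|A - E_\mu\|_{L_2(\mu)\to L_2(\mu)}$. Let $f_1, \ldots, f_n : [N] \to \{-1,1\}$ be functions such that $\mathbb{E}[f_i(Y_i)] = 0$ for every $i$. Let $x_0 \in \mathbb{R}^d$ and let $R \ge \frac{1}{C'\sqrt{d}}$. Then for all vectors $v_1, \ldots, v_n \in \mathbb{R}^d$ of Euclidean length at least $1$, $$\Pr\big[\|f_1(Y_1)v_1 + f_2(Y_2)v_2 + \cdots + f_n(Y_n)v_n - x_0\|_{\ell_2} \le R\big] \le \frac{C \cdot R\sqrt{d}}{(1-\lambda)\sqrt{n}}.$$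
   Context: $[N] = \{1,\ldots,N\}$. The chain has transition matrix $A \in \mathbb{R}^{N\times N}$ (a stochastic matrix), with $\Pr[Y_{i+1} = b \mid Y_i = a] = A_{ab}$; reversible means $\mu_a A_{ab} = \mu_b A_{ba}$ for all $a,b \in [N]$; stationary means $Y_1$ (hence every $Y_i$) has distribution $\mu$. The averaging operator $E_\mu$ is the $N\times N$ matrix with entries $(E_\mu)_{ij} = \mu_j$. For $v$ a vector indexed by $[N]$, $\|v\|_{L_2(\mu)}^2 = \sum_{i=1}^N |v_i|^2\mu_i$, and $\|M\|_{L_2(\mu)\to L_2(\mu)} = \max_{v : \|v\|_{L_2(\mu)} = 1} \|Mv\|_{L_2(\mu)}$. $\|\cdot\|_{\ell_2}$ is the Euclidean norm on $\mathbb{R}^d$. ''Universal constant'' means a constant independent of all other data ($N, n, d$, the chain, the $f_i$, the $v_i$, $x_0$, $R$). One always has $0 \le \lambda \le 1$; when $\lambda = 1$ the right-hand side is read as $+\infty$. *)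

(* Defs.v *)
From HB Require Import structures.
From mathcomp Require Import all_boot all_order all_algebra.
From mathcomp Require Import all_classical all_reals all_analysis.

Set Implicit Arguments.
Unset Strict Implicit.
Unset Printing Implicit Defensive.

Import Order.TTheory GRing.Theory Num.Theory.

Local Open Scope classical_set_scope.
Local Open Scope ring_scope.

(* The library norm on 'rV[R]_d is the sup norm, hence this definition. *)
Definition l2norm (R : realType) (d : nat) (x : 'rV[R]_d) : R :=
  Num.sqrt (\sum_(i < d) x 0 i ^+ 2).

Definition L2norm (R : realType) (N : nat) (mu : 'rV[R]_N) (v : 'cV[R]_N) : R :=
  Num.sqrt (\sum_(i < N) `|v i 0| ^+ 2 * mu 0 i).

(* The supremum is a maximum as soon as [L2norm mu v = 0] implies
   [L2norm mu (M *m v) = 0]; this holds for [A - averaging mu] when [A] is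
   reversible with respect to [mu], even if [mu] vanishes at some states.
   For other [M] the set may be unbounded, and [sup] is then 0. *)
Definition L2opnorm (R : realType) (N : nat) (mu : 'rV[R]_N) (M : 'M[R]_N) : R :=
  sup [set L2norm mu (M *m v) | v in [set v : 'cV[R]_N | L2norm mu v = 1]].

Definition averaging (R : realType) (N : nat) (mu : 'rV[R]_N) : 'M[R]_N :=
  \matrix_(i, j) mu 0 j.

Definition prob_vector (R : realType) (N : nat) (mu : 'rV[R]_N) : Prop :=
  (forall a, 0 <= mu 0 a) /\ \sum_(a < N) mu 0 a = 1.

Definition stochastic (R : realType) (N : nat) (A : 'M[R]_N) : Prop :=
  (forall a b, 0 <= A a b) /\ (forall a, \sum_(b < N) A a b = 1).

Definition reversible (R : realType) (N : nat) (mu : 'rV[R]_N) (A : 'M[R]_N) :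
    Prop :=
  forall a b, mu 0 a * A a b = mu 0 b * A b a.

Definition condPr (dsp : measure_display) (T : measurableType dsp)
    (R : realType) (P : probability T R) (E F : set T) : R :=
  fine (P (E `&` F)) / fine (P F).

(* [Y k] is the (k+1)-st variable of the chain. Conditional probabilities are
   only constrained when the conditioning event has nonzero probability. *)
Record stationary_reversible_chain (dsp : measure_display)
    (T : measurableType dsp) (R : realType) (P : probability T R) (N : nat)
    (A : 'M[R]_N) (mu : 'rV[R]_N) (Y : nat -> T -> 'I_N) : Prop := {
  chain_measurable : forall k (B : set 'I_N), measurable (Y k @^-1` B) ;
  chain_stochastic : stochastic A ;
  chain_prob_vector : prob_vector mu ;
  chain_transition : forall k (a b : 'I_N),
    P [set w | Y k w = a] != 0%E ->
    condPr P [set w | Y k.+1 w = b] [set w | Y k w = a] = A a b ;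
  chain_markov : forall k (s : nat -> 'I_N) (b : 'I_N),
    P [set w | forall j, (j <= k)%N -> Y j w = s j] != 0%E ->
    condPr P [set w | Y k.+1 w = b]
             [set w | forall j, (j <= k)%N -> Y j w = s j] =
    condPr P [set w | Y k.+1 w = b] [set w | Y k w = s k] ;
  chain_reversible : reversible mu A ;
  chain_stationary : forall a, P [set w | Y 0%N w = a] = (mu 0 a)%:E
}.

(* Main.v *)
Require Import Defs.
From HB Require Import structures.
From mathcomp Require Import all_boot all_order all_algebra.
From mathcomp Require Import all_classical all_reals all_analysis.
From mathcomp Require Import ring lra.
From mathcomp Require Import zify.

Set Implicit Arguments.
Unset Strict Implicit.
Unset Printing Implicit Defensive.

Import Order.TTheory GRing.Theory Num.Theory.
Import numFieldNormedType.Exports.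

Local Open Scope classical_set_scope.
Local Open Scope ring_scope.

(** The theorem is a small-ball estimate, proved through characteristic
functions that are averaged over finitely many frequencies, so that sums
replace all integrals.

Reduction to the line.  For a uniformly random sign vector e in dimension d,
<v, e> has second moment |v|^2 and fourth moment at most 3 |v|^4, hence
|<v, e>| >= 1/2 with probability at least 1/5 when |v| >= 1.  Some e
therefore works for at least n/5 of the v_i ([good_signs]).  Since
|<x, e>| <= sqrt d |x|, it suffices to bound the probability that the scalar
sum X = sum_i a_i f_i(Y_i), a_i = 2 <v_i, e>, lies within 2 r sqrt d of a
point, knowing |a_i| >= 1 for n/5 of the indices
([small_ball_signed_sum]).

Spectral gap.  On L2(mu) write A = (1 - lam) E + (A - (1 - lam) E); the second
operator has norm at most lam, because A - E kills the constants and maps into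
their orthogonal complement.  If D is the multiplication by exp(i xi a f),
where f = +-1 has mean 0, then E D E = cos(xi a) E.  So in a product A D A the
averaging is hit on both sides of D with weight p = (1 - lam)^2, and
|A D A| <= 1 - p + p |cos(xi a)| ([energy_two_steps]).  Applying this to
every other factor of the product that represents the characteristic function
phi of X, once for each parity, gives
|phi(xi)|^2 <= prod_i (1 - p + p |cos(xi a_i)|) ([sqr_mean_path_exp_cos_le]).

Back to simple random walk.  By the inequality of arithmetic and geometric
means, |phi| is at most an average over the m good indices of
(1 - p + p |cos(xi a_i)|)^(m/2), that is, of |cos(xi a_i)|^B with
B binomial(m/2, p).  The frequency xi is s times the endpoint of a simple
random walk of 2k steps, so that the average over xi of cos(xi t) is
cos(s t)^(2k): a nonnegative kernel, at least 1/2 on the ball of radius r and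
with Lorentzian decay when k is large and 2 k s^2 r^2 = 1.  Expanding the even
power of cos(xi a) as an average over a second, independent walk and exchanging
the two averages leaves the mean of the kernel over a walk of about B
steps, whose spacing is at least 2 and whose point probabilities are
O(1 / sqrt (B + 1)): this is O((1 + r) / sqrt (B + 1))
([walk_cos_even_le]).  Finally the mean of 1 / sqrt (B + 1) is at most
1 / sqrt (p (m/2 + 1)), and sqrt p = 1 - lam gives the stated dependence on
the gap. *)

(** * Simple random walk *)

Section Walk.
Variable R : realType.
Implicit Types (F : R -> R) (a x y t : R).

(** The endpoints of the [2 ^ k] sign paths of length [k], with multiplicity:
averages over this list are expectations over a simple random walk. *)
Fixpoint walk k : seq R :=
  if k is k'.+1 then [seq y + 1 | y <- walk k'] ++ [seq y - 1 | y <- walk k']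
  else [:: 0].

Lemma sum_walkS k F :
  \sum_(y <- walk k.+1) F y =
  \sum_(y <- walk k) F (y + 1) + \sum_(y <- walk k) F (y - 1).
Proof. by rewrite /= big_cat !big_map. Qed.

(** The characteristic function of the walk, unnormalized; the phase [t] is
what makes the induction on the number of steps go through. *)
Lemma sum_walk_cos k a t :
  \sum_(y <- walk k) cos (a * y + t) = (2 * cos a) ^+ k * cos t.
Proof.
elim: k t => [|k IH] t; first by rewrite big_seq1 mulr0 add0r mul1r.
rewrite sum_walkS.
under eq_bigr => y _ do rewrite mulrDr mulr1 -addrA.
under [X in _ + X]eq_bigr => y _ do rewrite mulrBr mulr1 -addrA.
rewrite !IH -mulrDr exprSr -mulrA; congr (_ * _).
by rewrite [- a + t]addrC cosB cosD; ring.
Qed.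

Lemma sum_walk_bin k F :
  \sum_(y <- walk k) F y =
  \sum_(j < k.+1) 'C(k, j)%:R * F (2 * j%:R - k%:R).
Proof.
elim: k F => [|k IH] F.
  by rewrite big_seq1 big_ord_recl big_ord0 bin0 mul1r addr0 mulr0 subr0.
rewrite sum_walkS !IH [RHS]big_ord_recl /=.
rewrite big_ord_recr /= [in RHS]big_ord_recr /=.
rewrite !binn !bin0 !mul1r.
under [in RHS]eq_bigr => j _ do rewrite binS natrD mulrDl.
rewrite big_split /= [X in _ + X = _]big_ord_recl /= bin0 mul1r.
have -> : F (2 * k%:R - k%:R + 1) = F (2 * (bump 0 k)%:R - k.+1%:R).
  by congr F; rewrite /bump /= !natrD; ring.
have -> : F (2 * 0%:R - k%:R - 1) = F (2 * 0%:R - k.+1%:R).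
  by congr F; rewrite -natr1; ring.
have -> : \sum_(i < k) 'C(k, i)%:R * F (2 * i%:R - k%:R + 1) =
   \sum_(i < k) 'C(k, i)%:R * F (2 * (bump 0 i)%:R - k.+1%:R).
  apply: eq_bigr => i _; congr (_ * F _).
  by rewrite /bump /= natrD -natr1; ring.
have -> : \sum_(i < k) 'C(k, bump 0 i)%:R * F (2 * (bump 0 i)%:R - k%:R - 1) =
  \sum_(i < k) 'C(k, i.+1)%:R * F (2 * (bump 0 i)%:R - k.+1%:R).
  apply: eq_bigr => i _; congr (_ * F _).
  by rewrite -natr1; ring.
by ring.
Qed.

Lemma bin_le_central c j : ('C(c.*2, j) <= 'C(c.*2, c))%N.
Proof.
have up i : (i < c)%N -> ('C(c.*2, i) <= 'C(c.*2, i.+1))%N.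
  move=> ic; rewrite -(leq_pmul2l (ltn0Sn i)) mul_bin_left leq_mul2r.
  by apply/orP; right; lia.
have low m i : (i + m = c)%N -> ('C(c.*2, i) <= 'C(c.*2, c))%N.
  elim: m i => [|m IH] i ei; first by rewrite -ei addn0.
  have lt : (i < c)%N by lia.
  by apply: (leq_trans (up _ lt)); apply: IH; lia.
case: (leqP j c) => [/subnKC/low//|cj].
case: (leqP j c.*2) => [jc|/bin_small -> //].
by rewrite -bin_sub //; apply: (low (j - c)%N); lia.
Qed.

(** The ratio of consecutive central binomial coefficients is
[4 * (2c+1) / (2c+2)], and [(2c+1) (2c+3) <= (2c+2)^2]. *)
Lemma central_bin_le c :
  ('C(c.*2, c)%:R : R) ^+ 2 * c.*2.+1%:R <= (4 ^+ c) ^+ 2.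
Proof.
elim: c => [|c IH]; first by rewrite bin0 !expr1n mul1r.
have step : (c.+1 * 'C(c.+1.*2, c.+1) = 2 * (c.*2.+1 * 'C(c.*2, c)))%N.
  have e1 := mul_bin_diag c.*2.+2 c; rewrite /= in e1.
  have e2 := mul_bin_down c.*2.+1 c; rewrite /= in e2.
  rewrite doubleS -e1 e2.
  rewrite (_ : c.*2.+1 - c = c.+1)%N; last by lia.
  have : (c.*2.+2 * 'C(c.*2.+1, c) = 2 * (c.+1 * 'C(c.*2.+1, c)))%N by lia.
  by [].
have stepR : c.+1%:R * 'C(c.+1.*2, c.+1)%:R =
    2 * (c.*2.+1%:R * 'C(c.*2, c)%:R) :> R.
  by rewrite -!natrM step.
have c0 : 0 < (c.+1%:R : R) ^+ 2 by rewrite exprn_gt0.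
rewrite -(ler_pM2l c0) mulrA -exprMn stepR.
have -> : (2 * (c.*2.+1%:R * 'C(c.*2, c)%:R)) ^+ 2 * c.+1.*2.+1%:R =
  ('C(c.*2, c)%:R ^+ 2 * c.*2.+1%:R) * (4 * (c.*2.+1%:R * c.+1.*2.+1%:R)) :> R.
  by ring.
have -> : c.+1%:R ^+ 2 * (4 ^+ c.+1) ^+ 2 = (4 ^+ c) ^+ 2 * (16 * c.+1%:R ^+ 2) :> R.
  by move: (c.+1%:R : R) => u; rewrite (exprS 4); ring.
apply: ler_pM => //.
by rewrite -!natrX -!natrM ler_nat; nia.
Qed.

(** A walk of even length visits each point with probability at most that of
its starting point, which is at most the inverse square root of the length
plus one. *)
Lemma sum_walk_le c F : (forall y, 0 <= F y) ->
  \sum_(y <- walk c.*2) F y <=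
  4 ^+ c / Num.sqrt c.*2.+1%:R * \sum_(j < c.*2.+1) F (2 * j%:R - c.*2%:R).
Proof.
move=> F0; rewrite sum_walk_bin mulr_sumr; apply: ler_sum => j _.
apply: ler_wpM2r => //.
have s0 : 0 < Num.sqrt (c.*2.+1%:R : R) by rewrite sqrtr_gt0.
rewrite ler_pdivlMr // -(@ler_pXn2r _ 2) ?nnegrE ?mulr_ge0 ?sqrtr_ge0 ?exprn_ge0 //.
rewrite exprMn sqr_sqrtr //; apply: le_trans (central_bin_le c).
by apply: ler_wpM2r => //; rewrite lerXn2r ?nnegrE // ler_nat bin_le_central.
Qed.

End Walk.

(** * Even powers of the cosine as a kernel *)

Section Kernel.
Variable R : realType.
Implicit Types (F : R -> R) (a r s t u x y : R).

Lemma sin_mvt x : exists2 c, `|c| <= `|x| & sin x = x * cos c.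
Proof.
wlog x0 : x / 0 <= x.
  move=> H; case: (leP 0 x) => [/H//|/ltW x0].
  have [|c cx e] := H (- x); first by rewrite oppr_ge0.
  by exists c; [rewrite normrN in cx|move: e; rewrite sinN mulNr => /oppr_inj].
have sin_cont : {within `[0, x], continuous (@sin R)}.
  by apply: continuous_subspaceT => y; exact: continuous_sin.
have [c] := MVT_segment x0 (fun y _ => is_derive_sin y) sin_cont.
rewrite in_itv /= sin0 !subr0 => /andP[c0 cx] ->; exists c; last by rewrite mulrC.
by rewrite !ger0_norm.
Qed.

Lemma sqr_sin_le x : sin x ^+ 2 <= x ^+ 2.
Proof.
have [c _ ->] := sin_mvt x; by rewrite exprMn ler_piMr ?sqr_ge0 // cos2sin2 gerBl sqr_ge0.
Qed.

(** The mean value theorem gives [sin x = x * cos c] with [|c| <= 1/2], and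
[cos c ^ 2 >= 1 - c ^ 2]. *)
Lemma sqr_sin_ge x : `|x| <= 1 / 2 -> x ^+ 2 / 2 <= sin x ^+ 2.
Proof.
move=> x2; have [c cx ->] := sin_mvt x; rewrite exprMn.
apply: ler_wpM2l; first exact: sqr_ge0.
have c2 : `|c| <= 1 / 2 by apply: le_trans x2.
have : `|c| ^+ 2 <= (1 / 2) ^+ 2 by rewrite lerXn2r ?nnegrE.
rewrite real_normK ?num_real // expr_div_n expr1n.
by have := sqr_sin_le c; rewrite sin2cos2; lra.
Qed.

Lemma bernoulli_le k u : 0 <= u <= 1 -> 1 - k%:R * u <= (1 - u) ^+ k.
Proof.
move=> /andP[u0 u1]; elim: k => [|k IH]; first by rewrite mul0r subr0.
rewrite exprS; apply: le_trans (_ : (1 - u) * (1 - k%:R * u) <= _).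
  rewrite -natr1; have : 0 <= k%:R * (u * u) by rewrite !mulr_ge0.
  by lra.
by rewrite ler_wpM2l // subr_ge0.
Qed.

(** As [(1 - u) (1 + (k + 1) u) <= 1 + k u], the product
[(1 - u) ^ k * (1 + k u)] decreases with [k] from [1]. *)
Lemma bernoulli_ge k u : 0 <= u <= 1 -> (1 - u) ^+ k <= (1 + k%:R * u)^-1.
Proof.
move=> /andP[u0 u1]; have ku0 m : 0 < 1 + m%:R * u.
  by rewrite ltr_pwDl // mulr_ge0.
rewrite -[_^-1]mul1r ler_pdivlMr //; elim: k => [|k IH].
  by rewrite mul0r addr0 mulr1.
apply: le_trans IH; rewrite exprSr -mulrA ler_wpM2l ?exprn_ge0 ?subr_ge0 //.
rewrite -natr1; have : 0 <= k%:R * (u * u) by rewrite !mulr_ge0.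
have : 0 <= u * u by rewrite mulr_ge0.
by lra.
Qed.

Lemma sqr_sin_itv u : 0 <= sin u ^+ 2 <= 1.
Proof. by rewrite sqr_ge0 sin2cos2 gerBl sqr_ge0. Qed.

Lemma cos_expn_double u k : cos u ^+ k.*2 = (1 - sin u ^+ 2) ^+ k.
Proof. by rewrite -cos2sin2 -muln2 mulnC exprM. Qed.

(** On the scale [u ~ 1 / sqrt k] the kernel is still close to [1]; this is
what lets it dominate the indicator of a ball. *)
Lemma cos_expn_ge k u : k%:R * u ^+ 2 <= 1 / 2 -> 1 / 2 <= cos u ^+ k.*2.
Proof.
move=> ku; rewrite cos_expn_double.
apply: le_trans (bernoulli_le k (sqr_sin_itv u)).
have : k%:R * sin u ^+ 2 <= k%:R * u ^+ 2 by rewrite ler_wpM2l // sqr_sin_le.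
by lra.
Qed.

Lemma cos_expn_le k u : `|u| <= 1 / 2 ->
  cos u ^+ k.*2 <= (1 + k%:R * u ^+ 2 / 2)^-1.
Proof.
move=> u2; rewrite cos_expn_double.
apply: le_trans (bernoulli_ge k (sqr_sin_itv u)) _.
rewrite lef_pV2 ?posrE; last 2 first.
- by rewrite ltr_pwDl // mulr_ge0 // sqr_ge0.
- by rewrite ltr_pwDl // divr_ge0 // mulr_ge0 // sqr_ge0.
by rewrite lerD2l -mulrA ler_wpM2l // sqr_sin_ge.
Qed.

(** The walk of even length lives on the even integers, so that a symmetric
function is summed over the origin and twice over the positive side. *)
Lemma sum_even_fun c F : (forall y, F (- y) = F y) ->
  \sum_(j < c.*2.+1) F (2 * j%:R - c.*2%:R) =
  F 0 + 2 * \sum_(i < c) F (2 * i.+1%:R).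
Proof.
move=> F_even; elim: c => [|c IH].
  by rewrite big_ord_recl !big_ord0 /= !mulr0 subr0.
rewrite big_ord_recl big_ord_recr /= [in RHS]big_ord_recr /= [in RHS]mulrDr [RHS]addrA -IH.
have -> : \sum_(i < c.*2.+1) F (2 * (bump 0 i)%:R - c.+1.*2%:R) =
          \sum_(j < c.*2.+1) F (2 * j%:R - c.*2%:R).
  apply: eq_bigr => i _; congr F; rewrite /bump /= natrD doubleS -!natr1.
  by move: (c.*2%:R : R) => w; ring.
have e : 2 * c.+1%:R = c.+1.*2%:R :> R by rewrite -natrM mul2n.
have -> : 2 * (bump 0 c.*2.+1)%:R - c.+1.*2%:R = 2 * c.+1%:R :> R.
  rewrite e /bump /= add1n -natrM mul2n -natrB; last by lia.
  by congr (_%:R); lia.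
by rewrite mulr0 sub0r F_even -e; ring.
Qed.

(** Compare with the telescoping sequence [2 r i / (r + i)], whose increments
dominate the summands because [(r+i)(r+i-1) <= 2 (r^2 + i^2)]. *)
Lemma sum_lorentz_le r c : 0 < r ->
  \sum_(i < c) (1 + (i.+1%:R / r) ^+ 2)^-1 <= 2 * r.
Proof.
move=> r0; apply: le_trans (_ : 2 * r * (c%:R / (r + c%:R)) <= _); last first.
  rewrite ler_piMr ?mulr_ge0 ?(ltW r0) // ler_pdivrMr ?mul1r ?ltr_wpDr //.
  by rewrite lerDr ltW.
elim: c => [|c IH]; first by rewrite big_ord0 mul0r mulr0.
rewrite big_ord_recr /=; apply: le_trans (lerD IH (lexx _)) _.
rewrite -lerBrDl -natr1; move: (c%:R : R) (ler0n R c) => x x0.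
have -> : 2 * r * ((x + 1) / (r + (x + 1))) - 2 * r * (x / (r + x)) =
  (((r + x) * (r + x + 1)) / (2 * r ^+ 2))^-1.
  by field; rewrite !gt_eqF //=; lra.
rewrite lef_pV2 ?posrE; last 2 first.
- by rewrite ltr_pwDl // sqr_ge0.
- by rewrite divr_gt0 ?mulr_gt0 ?exprn_gt0 //; lra.
rewrite ler_pdivrMr ?mulr_gt0 ?exprn_gt0 //.
have -> : (1 + ((x + 1) / r) ^+ 2) * (2 * r ^+ 2) = 2 * (r ^+ 2 + (x + 1) ^+ 2).
  by field; rewrite gt_eqF.
have := sqr_ge0 (r - x - 1); rewrite !expr2; nra.
Qed.

(** The even power of the cosine is the characteristic function of a second
walk of [2c] steps; after exchanging the two walks, the frequency walk produces
the kernel [cos ^ 2k], evaluated at points of spacing at least [2 |a| >= 2].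
The bound on [2 s a c] keeps all these points in the first period of the
kernel, where it decays. *)
Lemma walk_cos_even_le (k c : nat) r a s :
  0 < r -> 1 <= `|a| -> (0 < k)%N -> s ^+ 2 = (2 * k%:R * r ^+ 2)^-1 ->
  `|2 * s * a| * c%:R <= 1 / 2 ->
  (\sum_(y <- walk R k.*2) cos (s * y * a) ^+ c.*2) / 4 ^+ k <=
  (1 + 4 * r) / Num.sqrt c.*2.+1%:R.
Proof.
move=> r0 a1 k0 s2 sac.
have four m : (2 : R) ^+ m.*2 = 4 ^+ m by rewrite -muln2 mulnC exprM -natrX.
have sum_cos n z : \sum_(y <- walk R n.*2) cos (z * y) = 4 ^+ n * cos z ^+ n.*2.
  have := sum_walk_cos n.*2 z 0; rewrite cos0 mulr1 exprMn four => <-.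
  by apply: eq_bigr => y _; rewrite addr0.
have e y : cos (s * y * a) ^+ c.*2 =
    (\sum_(z <- walk R c.*2) cos (s * a * z * y)) / 4 ^+ c.
  rewrite (eq_bigr (fun z => cos (s * y * a * z))); last first.
    by move=> z _; congr cos; ring.
  by rewrite sum_cos [RHS]mulrAC divff ?mul1r // expf_neq0.
have c0 : 0 < 4 ^+ c :> R by rewrite exprn_gt0.
have s0 : 0 < Num.sqrt (c.*2.+1%:R : R) by rewrite sqrtr_gt0.
have -> : (\sum_(y <- walk R k.*2) cos (s * y * a) ^+ c.*2) / 4 ^+ k =
    (\sum_(z <- walk R c.*2) cos (s * a * z) ^+ k.*2) / 4 ^+ c.
  under eq_bigr => y _ do rewrite e.
  rewrite -mulr_suml exchange_big /= mulrAC; congr (_ / _).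
  rewrite mulr_suml; apply: eq_bigr => z _.
  by rewrite sum_cos [LHS]mulrAC divff ?mul1r // expf_neq0.
have ge0 y : 0 <= cos (s * a * y) ^+ k.*2.
  by rewrite cos_expn_double exprn_ge0 // subr_ge0; case/andP: (sqr_sin_itv (s * a * y)).
rewrite ler_pdivrMr //; apply: le_trans (sum_walk_le c ge0) _.
have -> : (1 + 4 * r) / Num.sqrt c.*2.+1%:R * 4 ^+ c =
    4 ^+ c / Num.sqrt c.*2.+1%:R * (1 + 4 * r) by ring.
apply: ler_wpM2l; first by rewrite divr_ge0 // ltW.
rewrite (@sum_even_fun c (fun y => cos (s * a * y) ^+ k.*2)); last first.
  by move=> y; rewrite mulrN cosN.
rewrite mulr0 cos0 expr1n lerD2l.
rewrite (_ : 4 * r = 2 * (2 * r)); last by ring.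
rewrite ler_wpM2l //; apply: le_trans (sum_lorentz_le c r0).
apply: ler_sum => i _; apply: le_trans (cos_expn_le k _) _.
  apply: le_trans sac; rewrite (_ : _ * _ = 2 * s * a * i.+1%:R); last by ring.
  rewrite normrM normr_nat.
  by rewrite ler_wpM2l // ler_nat.
rewrite lef_pV2 ?posrE; last 2 first.
- by rewrite ltr_pwDl // divr_ge0 // mulr_ge0 // sqr_ge0.
- by rewrite ltr_pwDl // sqr_ge0.
rewrite lerD2l.
have -> : k%:R * (s * a * (2 * i.+1%:R)) ^+ 2 / 2 = a ^+ 2 * (i.+1%:R / r) ^+ 2.
  rewrite (_ : _ * _ / _ = (k%:R * a ^+ 2 * (2 * i.+1%:R) ^+ 2 / 2) * s ^+ 2); last by ring.
  by rewrite s2; field; rewrite !gt_eqF ?ltr0n.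
rewrite ler_peMl ?sqr_ge0 // -(real_normK (num_real a)).
by rewrite exprn_ege1.
Qed.

End Kernel.

(** * Reversible chains as operators on square-integrable functions *)

Section WeightedJensen.
Variables (R : realType) (I : finType).
Implicit Types (w x : I -> R).

Lemma wsum_sqrB w x k : \sum_a w a = 1 ->
  \sum_a w a * (x a - k) ^+ 2 =
  \sum_a w a * x a ^+ 2 - 2 * k * (\sum_a w a * x a) + k ^+ 2.
Proof.
move=> w1; have -> : k ^+ 2 = \sum_a w a * k ^+ 2 by rewrite -mulr_suml w1 mul1r.
rewrite mulr_sumr -sumrB -big_split /=.
by apply: eq_bigr => a _; ring.
Qed.

(** Nonnegativity of the variance. *)
Lemma jensen_sqr w x : (forall a, 0 <= w a) -> \sum_a w a = 1 ->
  (\sum_a w a * x a) ^+ 2 <= \sum_a w a * x a ^+ 2.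
Proof.
move=> w0 w1; have := wsum_sqrB x (\sum_a w a * x a) w1.
have : 0 <= \sum_a w a * (x a - \sum_a w a * x a) ^+ 2.
  by apply: sumr_ge0 => a _; rewrite mulr_ge0 // sqr_ge0.
by move=> /[swap] ->; lra.
Qed.

End WeightedJensen.

Lemma sqr_norm2D_le (R : realType) (a1 a2 b1 b2 A B : R) : 0 <= A -> 0 <= B ->
  a1 ^+ 2 + a2 ^+ 2 <= A ^+ 2 -> b1 ^+ 2 + b2 ^+ 2 <= B ^+ 2 ->
  (a1 + b1) ^+ 2 + (a2 + b2) ^+ 2 <= (A + B) ^+ 2.
Proof.
move=> A0 B0 ha hb.
have cs : a1 * b1 + a2 * b2 <= A * B.
  apply: le_trans (ler_norm _) _.
  rewrite -(@ler_pXn2r _ 2) ?nnegrE ?mulr_ge0 // real_normK ?num_real //.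
  apply: (@le_trans _ _ ((a1 ^+ 2 + a2 ^+ 2) * (b1 ^+ 2 + b2 ^+ 2))).
    by have := sqr_ge0 (a1 * b2 - a2 * b1); lra.
  by rewrite exprMn ler_pM // addr_ge0 // sqr_ge0.
by lra.
Qed.

Section ChainOperator.
Variables (R : realType) (N : nat) (mu : 'rV[R]_N) (A : 'M[R]_N).
Hypothesis mu_prob : prob_vector mu.
Hypothesis A_stoch : stochastic A.
Hypothesis A_rev : reversible mu A.
Implicit Types (x y th : 'I_N -> R) (u : ('I_N -> R) * ('I_N -> R)).

Definition mean x : R := \sum_a mu 0 a * x a.
Definition transition x : 'I_N -> R := fun a => \sum_b A a b * x b.

Lemma mean_transition x : mean (transition x) = mean x.
Proof.
rewrite /mean /transition; under eq_bigr => a _ do rewrite mulr_sumr.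
rewrite exchange_big /=; apply: eq_bigr => b _.
under eq_bigr => a _ do rewrite mulrA A_rev.
by rewrite -mulr_suml -mulr_sumr A_stoch.2 mulr1.
Qed.

Lemma le_mean x y : (forall a, x a <= y a) -> mean x <= mean y.
Proof. by move=> xy; apply: ler_sum => a _; rewrite ler_wpM2l // mu_prob.1. Qed.

Lemma sqr_mean_le x : mean x ^+ 2 <= mean (fun a => x a ^+ 2).
Proof. by apply: jensen_sqr; [exact: mu_prob.1|exact: mu_prob.2]. Qed.

Lemma mean_sqrB x k : mean (fun a => (x a - k) ^+ 2) =
  mean (fun a => x a ^+ 2) - 2 * k * mean x + k ^+ 2.
Proof. exact: wsum_sqrB mu_prob.2. Qed.

Lemma mean_cst k : mean (fun=> k) = k.
Proof. by rewrite /mean -mulr_suml mu_prob.2 mul1r. Qed.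

Lemma transition_cst k a : transition (fun=> k) a = k.
Proof. by rewrite /transition -mulr_suml A_stoch.2 mul1r. Qed.

Lemma mean_sqr_transition x :
  mean (fun a => transition x a ^+ 2) <= mean (fun a => x a ^+ 2).
Proof.
rewrite -[leRHS]mean_transition; apply: le_mean => a.
by apply: jensen_sqr; [exact: A_stoch.1|exact: A_stoch.2].
Qed.

(** This is [|A - E| <= lam] on L2(mu), in squared form. *)
Definition contracts (lam : R) : Prop := forall x,
  mean (fun a => (transition x a - mean x) ^+ 2) <= lam ^+ 2 * mean (fun a => x a ^+ 2).

Section Opnorm.
Let lam := L2opnorm mu (A - averaging mu).

Lemma L2norm_mean (v : 'cV[R]_N) :
  L2norm mu v = Num.sqrt (mean (fun a => v a 0 ^+ 2)).
Proof.
congr Num.sqrt; apply: eq_bigr => a _.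
by rewrite real_normK ?num_real // mulrC.
Qed.

Lemma L2norm_centred (v : 'cV[R]_N) : L2norm mu ((A - averaging mu) *m v) =
  Num.sqrt (mean (fun a => (transition (v^~ 0) a - mean (v^~ 0)) ^+ 2)).
Proof.
rewrite L2norm_mean; congr (Num.sqrt (mean _)); apply/funext => a.
rewrite mxE /transition /mean -sumrB; congr (_ ^+ 2); apply: eq_bigr => b _.
by rewrite !mxE; ring.
Qed.

(** [A - E] has norm at most [1]: centring can only decrease the norm, and
[A] contracts L2(mu) by convexity and stationarity.  In particular vectors of
norm zero are mapped to vectors of norm zero, as is needed where [mu]
vanishes. *)
Lemma L2norm_centred_le (v : 'cV[R]_N) :
  L2norm mu ((A - averaging mu) *m v) <= L2norm mu v.
Proof.
rewrite L2norm_centred L2norm_mean ler_wsqrtr // mean_sqrB mean_transition.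
apply: le_trans (mean_sqr_transition (v^~ 0)).
by have := sqr_ge0 (mean (v^~ 0)); lra.
Qed.

Let S := [set L2norm mu ((A - averaging mu) *m v) | v in
          [set v : 'cV[R]_N | L2norm mu v = 1]].

Let S_ub : ubound S 1.
Proof. by move=> _ [v /= v1 <-]; rewrite -v1 L2norm_centred_le. Qed.

Let S_0 : S 0.
Proof.
exists (const_mx 1) => /=.
  rewrite L2norm_mean (_ : (fun a => _) = (fun=> 1)) ?mean_cst ?sqrtr1 //.
  by apply/funext => a; rewrite mxE expr1n.
rewrite L2norm_centred (_ : (fun a => _) = (fun=> 0)) ?mean_cst ?sqrtr0 //.
have -> : (const_mx 1 : 'cV[R]_N)^~ 0 = (fun=> 1) by apply/funext => a; rewrite mxE.
by apply/funext => a; rewrite transition_cst mean_cst subrr expr0n.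
Qed.

Lemma L2opnorm_ge0 : 0 <= lam.
Proof. by apply: (@ub_le_sup _ S) => //; exists 1; exact: S_ub. Qed.

Lemma L2opnorm_le1 : lam <= 1.
Proof. by apply: ge_sup => //; exists 0; exact: S_0. Qed.

Lemma L2opnorm_contracts : contracts lam.
Proof.
move=> x; pose v : 'cV[R]_N := \col_a x a.
have vx : v^~ 0 = x by apply/funext => a; rewrite mxE.
have sq0 y : 0 <= mean (fun a => y a ^+ 2).
  by apply: sumr_ge0 => a _; rewrite mulr_ge0 ?sqr_ge0 // mu_prob.1.
have ex : mean (fun a => x a ^+ 2) = L2norm mu v ^+ 2.
  rewrite L2norm_mean sqr_sqrtr ?(sq0 (v^~ 0)) //.
  by congr mean; apply/funext => a; rewrite mxE.
have el : mean (fun a => (transition x a - mean x) ^+ 2) =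
    L2norm mu ((A - averaging mu) *m v) ^+ 2.
  by rewrite L2norm_centred vx sqr_sqrtr // (sq0 (fun a => transition x a - mean x)).
rewrite ex el -exprMn lerXn2r ?nnegrE ?sqrtr_ge0 //.
  by rewrite mulr_ge0 ?L2opnorm_ge0 // sqrtr_ge0.
have [v0|v0] := eqVneq (L2norm mu v) 0.
  by rewrite v0 mulr0 -v0 L2norm_centred_le.
have vgt0 : 0 < L2norm mu v by rewrite lt_def v0 sqrtr_ge0.
have scale (k : R) (z : 'cV[R]_N) : 0 <= k -> L2norm mu (k *: z) = k * L2norm mu z.
  move=> k0; rewrite !L2norm_mean -[k in RHS](ger0_norm k0) -sqrtr_sqr -sqrtrM ?sqr_ge0 //.
  congr Num.sqrt; rewrite /mean mulr_sumr; apply: eq_bigr => a _.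
  by rewrite mxE; ring.
rewrite -ler_pdivrMr // mulrC -scale ?invr_ge0 ?(ltW vgt0) // scalemxAr.
apply: (@ub_le_sup _ S); first by exists 1; exact: S_ub.
exists ((L2norm mu v)^-1 *: v) => //=.
by rewrite scale ?invr_ge0 ?(ltW vgt0) // mulVf.
Qed.

End Opnorm.

Section TwoSteps.
Variable lam : R.
Hypothesis lam_itv : 0 <= lam <= 1.
Hypothesis A_contr : contracts lam.

(** Pythagoras: [A] preserves the mean and multiplies the centred part by at
most [lam]. *)
Lemma mean_sqr_transition_le x : mean (fun a => transition x a ^+ 2) <=
  mean x ^+ 2 + lam ^+ 2 * (mean (fun a => x a ^+ 2) - mean x ^+ 2).
Proof.
have := A_contr (fun a => x a - mean x).
have -> : mean (fun a => x a - mean x) = 0.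
  rewrite -[RHS](subrr (mean x)) -[X in _ - X]mean_cst /mean -sumrB.
  by apply: eq_bigr => a _; rewrite mulrBr.
rewrite [in leLHS](_ : (fun a => _) = (fun a => (transition x a - mean x) ^+ 2)).
  by rewrite !mean_sqrB mean_transition; lra.
apply/funext => a; congr (_ ^+ 2); rewrite subr0 -[X in _ - X](transition_cst _ a).
by rewrite /transition -sumrB; apply: eq_bigr => b _; rewrite mulrBr.
Qed.

(** [A - (1 - lam) E] has norm at most [lam]: it acts as [lam] on constants and
as [A - E] on their orthogonal complement. *)
Lemma mean_sqr_transition_shift_le x :
  mean (fun a => (transition x a - (1 - lam) * mean x) ^+ 2) <=
  lam ^+ 2 * mean (fun a => x a ^+ 2).
Proof. by rewrite mean_sqrB mean_transition; have := mean_sqr_transition_le x; lra. Qed.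

(** Multiplication by [exp (i th)] on complex functions, a pair of real
functions standing for the real and imaginary parts. *)
Definition rot th u : ('I_N -> R) * ('I_N -> R) :=
  (fun a => cos (th a) * u.1 a - sin (th a) * u.2 a,
   fun a => sin (th a) * u.1 a + cos (th a) * u.2 a).

Definition transition2 u := (transition u.1, transition u.2).

(** The squared L2(mu) norm of a complex function. *)
Definition energy u : R :=
  mean (fun a => u.1 a ^+ 2) + mean (fun a => u.2 a ^+ 2).

Lemma energy_rot th u : energy (rot th u) = energy u.
Proof.
rewrite /energy /mean -!big_split /=; apply: eq_bigr => a _.
rewrite -!mulrDr; congr (_ * _).
transitivity ((cos (th a) ^+ 2 + sin (th a) ^+ 2) * (u.1 a ^+ 2 + u.2 a ^+ 2)).
  by ring.
by rewrite cos2Dsin2 mul1r.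
Qed.

Lemma energy_ge0 u : 0 <= energy u.
Proof.
by apply: addr_ge0; apply: sumr_ge0 => a _; rewrite mulr_ge0 ?sqr_ge0 // mu_prob.1.
Qed.

Lemma energy_transition2 u : energy (transition2 u) <= energy u.
Proof. by apply: lerD; exact: mean_sqr_transition. Qed.

Lemma sqr_mean2_le u : mean u.1 ^+ 2 + mean u.2 ^+ 2 <= energy u.
Proof. by apply: lerD; exact: sqr_mean_le. Qed.

(** A bound for the norm of [A D A] when the phase [D] has mean [c]: with weight
[(1 - lam) ^ 2] both copies of [A] act as the averaging operator. *)
Definition damping (c : R) : R := 1 - (1 - lam) ^+ 2 + (1 - lam) ^+ 2 * `|c|.

Lemma norm_mean_cos_le1 th : `|mean (cos \o th)| <= 1.
Proof.
rewrite ler_norml; apply/andP; split.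
  by rewrite -(mean_cst (-1)); apply: le_mean => a; exact: cos_geN1.
by rewrite -(mean_cst 1); apply: le_mean => a; exact: cos_le1.
Qed.

(** The constant part of a function, once rotated, contributes to the mean only
through the means of the cosine and the sine of the phase. *)
Lemma mean_rot1 th u k1 k2 : mean (rot th u).1 =
  k1 * mean (cos \o th) - k2 * mean (sin \o th) +
  mean (rot th (fun a => u.1 a - k1, fun a => u.2 a - k2)).1.
Proof.
rewrite /mean !mulr_sumr -sumrB -big_split /=.
by apply: eq_bigr => a _; ring.
Qed.

Lemma mean_rot2 th u k1 k2 : mean (rot th u).2 =
  k1 * mean (sin \o th) + k2 * mean (cos \o th) +
  mean (rot th (fun a => u.1 a - k1, fun a => u.2 a - k2)).2.
Proof.
rewrite /mean !mulr_sumr -!big_split /=.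
by apply: eq_bigr => a _; ring.
Qed.

(** Write [A u] as [(1 - lam) E u + y] with [|y| <= lam |u|].  After the
rotation the mean is at most [(1 - lam) |c| |u| + lam |u| = v |u|], since the
sine averages to zero, while the norm is still at most [|u|].  Applying [A]
once more weighs these two with [1 - lam] and [lam], and
[(1 - lam) v + lam] is the damping factor. *)
Lemma energy_two_steps th u : mean (sin \o th) = 0 ->
  energy (transition2 (rot th (transition2 u))) <=
  damping (mean (cos \o th)) ^+ 2 * energy u.
Proof.
set c := mean (cos \o th) => sin_mean0.
have c1 : `|c| <= 1 := norm_mean_cos_le1 th.
have [l0 l1] : 0 <= lam /\ lam <= 1 by case/andP: lam_itv.
pose S := Num.sqrt (energy u).
have S0 : 0 <= S by exact: sqrtr_ge0.
have S2 : energy u = S ^+ 2 by rewrite sqr_sqrtr ?energy_ge0.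
set z := rot th (transition2 u).
pose y : ('I_N -> R) * ('I_N -> R) :=
  (fun a => transition u.1 a - (1 - lam) * mean u.1,
   fun a => transition u.2 a - (1 - lam) * mean u.2).
have ylt : energy (rot th y) <= (lam * S) ^+ 2.
  rewrite energy_rot exprMn -S2 mulrDr.
  by apply: lerD; exact: mean_sqr_transition_shift_le.
have mz1 : mean z.1 = (1 - lam) * c * mean u.1 + mean (rot th y).1.
  rewrite /z (mean_rot1 _ (transition2 u) ((1 - lam) * mean u.1) ((1 - lam) * mean u.2)).
  by rewrite sin_mean0 -/c mulr0 ?subr0 ?add0r mulrAC; congr (_ + _).
have mz2 : mean z.2 = (1 - lam) * c * mean u.2 + mean (rot th y).2.
  rewrite /z (mean_rot2 _ (transition2 u) ((1 - lam) * mean u.1) ((1 - lam) * mean u.2)).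
  by rewrite sin_mean0 -/c mulr0 ?subr0 ?add0r mulrAC; congr (_ + _).
pose v := (1 - lam) * `|c| + lam.
have v01 : 0 <= v <= 1.
  have := normr_ge0 c; rewrite /v; move: `|c| c1 => t t1 t0.
  by apply/andP; split; nra.
have mz : mean z.1 ^+ 2 + mean z.2 ^+ 2 <= (v * S) ^+ 2.
  rewrite mz1 mz2 [v * S]mulrDl; apply: sqr_norm2D_le.
  - by rewrite !mulr_ge0 // subr_ge0.
  - by rewrite mulr_ge0.
  - rewrite !exprMn -mulrDr -S2 real_normK ?num_real //.
    by apply: ler_wpM2l (sqr_mean2_le u); rewrite mulr_ge0 ?sqr_ge0.
  - exact: le_trans (sqr_mean2_le _) ylt.
have ez : energy z <= S ^+ 2 by rewrite energy_rot -S2 energy_transition2.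
have -> : damping c = (1 - lam) * v + lam by rewrite /damping /v; ring.
have := lerD (mean_sqr_transition_le z.1) (mean_sqr_transition_le z.2).
rewrite -/(energy (transition2 z)) S2 => /le_trans; apply.
have -> : mean z.1 ^+ 2 + lam ^+ 2 * (mean (fun a => z.1 a ^+ 2) - mean z.1 ^+ 2) +
    (mean z.2 ^+ 2 + lam ^+ 2 * (mean (fun a => z.2 a ^+ 2) - mean z.2 ^+ 2)) =
    (1 - lam ^+ 2) * (mean z.1 ^+ 2 + mean z.2 ^+ 2) + lam ^+ 2 * energy z.
  by rewrite /energy; ring.
apply: (@le_trans _ _ ((1 - lam ^+ 2) * (v * S) ^+ 2 + lam ^+ 2 * S ^+ 2)).
  by apply: lerD; apply: ler_wpM2l => //; rewrite ?sqr_ge0 // subr_ge0 expr_le1.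
rewrite exprMn mulrA -mulrDl ler_wpM2r ?sqr_ge0 //.
(* The weights 1 - lam ^ 2 and lam ^ 2 do better than the square of a mean with
   weights 1 - lam and lam, because v <= 1. *)
rewrite -subr_ge0.
have -> : ((1 - lam) * v + lam) ^+ 2 - ((1 - lam ^+ 2) * v ^+ 2 + lam ^+ 2) =
  2 * (lam * (1 - lam)) * (v * (1 - v)) by ring.
by case/andP: v01 => v0 v1; rewrite !mulr_ge0 // subr_ge0.
Qed.

(** The product [A D_1 A D_2 ... A D_n 1] of transitions and phases. *)
Fixpoint transfer (ths : seq ('I_N -> R)) : ('I_N -> R) * ('I_N -> R) :=
  if ths is th :: ths' then transition2 (rot th (transfer ths')) else (fun=> 1, fun=> 0).

(** Even the innermost factor is preceded by a transition, because constants
are invariant; this spares a boundary case in the next induction. *)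
Lemma transfer_transition2 ths : exists2 w, transfer ths = transition2 w &
  energy w = energy (transfer (behead ths)).
Proof.
case: ths => [|th ths] /=; last by eexists; [reflexivity|exact: energy_rot].
exists (fun=> 1, fun=> 0) => //.
by congr (_, _); apply/funext => a; rewrite transition_cst.
Qed.

Lemma energy_transfer_behead ths :
  energy (transfer ths) <= energy (transfer (behead ths)).
Proof. by have [w -> <-] := transfer_transition2 ths; exact: energy_transition2. Qed.

Lemma damping_itv c : `|c| <= 1 -> 0 <= damping c <= 1.
Proof.
move=> c1; case/andP: lam_itv => l0 l1; have c0 := normr_ge0 c.
have p0 : 0 <= (1 - lam) ^+ 2 by exact: sqr_ge0.
have p1 : (1 - lam) ^+ 2 <= 1 by rewrite expr_le1 ?subr_ge0 // gerBl.
by rewrite /damping; move: ((1 - lam) ^+ 2) p0 p1 => p p0 p1; nra.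
Qed.

Lemma energy_one : energy (fun=> 1, fun=> 0) = 1.
Proof. by rewrite /energy /= !mean_cst expr1n expr0n addr0. Qed.

(** A factor of damping is gained every second step only.  Following the
product of two consecutive energies handles both parities at once: one step
replaces the older of the two. *)
Lemma energy_transfer_prod ths : (forall th, th \in ths -> mean (sin \o th) = 0) ->
  energy (transfer ths) * energy (transfer (behead ths)) <=
  \prod_(th <- ths) damping (mean (cos \o th)) ^+ 2.
Proof.
elim: ths => [_|th ths IH sin_mean0]; first by rewrite /= energy_one mulr1 big_nil.
rewrite big_cons /=; have [w e ew] := transfer_transition2 ths; rewrite {1}e.
apply: (@le_trans _ _ (damping (mean (cos \o th)) ^+ 2 * energy w *
    energy (transfer ths))).
  rewrite ler_wpM2r ?energy_ge0 // energy_two_steps // sin_mean0 //.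
  by rewrite inE eqxx.
rewrite -mulrA ler_wpM2l ?sqr_ge0 // ew mulrC IH // => th' ths'.
by rewrite sin_mean0 // inE ths' orbT.
Qed.

Lemma energy_transfer_le ths : (forall th, th \in ths -> mean (sin \o th) = 0) ->
  energy (transfer ths) <= \prod_(th <- ths) damping (mean (cos \o th)).
Proof.
move=> sin_mean0; rewrite -(@ler_pXn2r _ 2) ?nnegrE ?energy_ge0 //; last first.
  apply: prodr_ge0 => th _.
  by case/andP: (damping_itv (norm_mean_cos_le1 th)).
rewrite -prodrXl; apply: le_trans (energy_transfer_prod sin_mean0).
by rewrite expr2 ler_wpM2l ?energy_ge0 // energy_transfer_behead.
Qed.

(** The expectation of [F] over the trajectory of length [n] of the chain that
has left the state [a] given as last argument. *)
Fixpoint path_exp n (F : seq 'I_N -> R) : 'I_N -> R :=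
  if n is m.+1 then transition (fun b => path_exp m (fun s => F (b :: s)) b)
  else fun=> F [::].

Lemma eq_path_exp n (F G : seq 'I_N -> R) a : F =1 G -> path_exp n F a = path_exp n G a.
Proof. by move=> /funext ->. Qed.

Lemma le_path_exp n (F G : seq 'I_N -> R) a :
  (forall s, F s <= G s) -> path_exp n F a <= path_exp n G a.
Proof.
elim: n F G a => [|n IH] F G a FG /=; first exact: FG.
apply: ler_sum => b _; rewrite ler_wpM2l ?A_stoch.1 //.
by apply: IH => s; exact: FG.
Qed.

Lemma path_exp_sum (I : Type) (r : seq I) n (F : I -> seq 'I_N -> R) a :
  path_exp n (fun s => \sum_(i <- r) F i s) a = \sum_(i <- r) path_exp n (F i) a.
Proof.
elim: n F a => [//|n IH] F a /=; rewrite /transition exchange_big /=.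
by apply: eq_bigr => b _; rewrite IH mulr_sumr.
Qed.

Lemma path_exp_lin n k l (F G : seq 'I_N -> R) a :
  path_exp n (fun s => k * F s + l * G s) a = k * path_exp n F a + l * path_exp n G a.
Proof.
elim: n F G a => [//|n IH] F G a /=; rewrite /transition !mulr_sumr -big_split /=.
by apply: eq_bigr => b _; rewrite IH; ring.
Qed.

(** The recursion follows that of [transfer]: each phase consumes one state. *)
Fixpoint phase (ths : seq ('I_N -> R)) (s : seq 'I_N) : R :=
  if ths is th :: ths' then
    if s is b :: s' then th b + phase ths' s' else 0
  else 0.

Lemma transfer_path_exp ths a :
  (transfer ths).1 a = path_exp (size ths) (cos \o phase ths) a /\
  (transfer ths).2 a = path_exp (size ths) (sin \o phase ths) a.
Proof.
elim: ths a => [|th ths IH] a; first by rewrite /= cos0 sin0.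
rewrite /=; split; apply: eq_bigr => b _; congr (_ * _);
  rewrite (IH b).1 (IH b).2.
  rewrite -mulNr -path_exp_lin; apply: eq_path_exp => s /=.
  by rewrite cosD mulNr.
rewrite -path_exp_lin; apply: eq_path_exp => s /=.
by rewrite sinD.
Qed.

(** The left-hand side is the squared real part of [exp (-i t)] times the
characteristic function. *)
Lemma sqr_mean_path_exp_cos_le ths t :
  (forall th, th \in ths -> mean (sin \o th) = 0) ->
  mean (path_exp (size ths) (fun s => cos (phase ths s - t))) ^+ 2 <=
  \prod_(th <- ths) damping (mean (cos \o th)).
Proof.
move=> sin_mean0; apply: le_trans (energy_transfer_le sin_mean0).
apply: le_trans (sqr_mean2_le _).
have -> : mean (path_exp (size ths) (fun s => cos (phase ths s - t))) =
    cos t * mean (transfer ths).1 + sin t * mean (transfer ths).2.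
  rewrite /mean !mulr_sumr -big_split /=; apply: eq_bigr => a _.
  rewrite (transfer_path_exp ths a).1 (transfer_path_exp ths a).2.
  transitivity (mu 0 a * (cos t * path_exp (size ths) (cos \o phase ths) a +
     sin t * path_exp (size ths) (sin \o phase ths) a)); last by ring.
  rewrite -path_exp_lin; congr (_ * _); apply: eq_path_exp => s /=.
  by rewrite cosB; ring.
have := cos2Dsin2 t; have := sqr_ge0 (sin t * mean (transfer ths).1 -
  cos t * mean (transfer ths).2).
move: (mean (transfer ths).1) (mean (transfer ths).2) (cos t) (sin t) => x y c d sq cd.
by rewrite -[leRHS]mul1r -cd; lra.
Qed.

End TwoSteps.
End ChainOperator.

(** * The law of a trajectory *)

Definition traj (T S : Type) (Y : nat -> T -> S) n w := mkseq (Y^~ w) n.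

Section ChainLaw.
Variables (R : realType) (N : nat) (mu : 'rV[R]_N) (A : 'M[R]_N).
Variables (dsp : measure_display) (T : measurableType dsp) (P : probability T R).
Variable Y : nat -> T -> 'I_N.
Hypothesis chain : stationary_reversible_chain P A mu Y.

Let mu_prob := chain_prob_vector chain.
Let A_stoch := chain_stochastic chain.
Let A_rev := chain_reversible chain.

Lemma measurable_state k a : measurable [set w | Y k w = a].
Proof. exact: (chain_measurable chain k [set a]). Qed.

(** The conditional probability is meaningful only when [F] has positive
probability; otherwise both sides vanish. *)
Lemma condPr_prod (E F : set T) (c : R) : measurable E -> measurable F ->
  (P F != 0%E -> condPr P E F = c) -> P (E `&` F) = (c * fine (P F))%:E.
Proof.
move=> mE mF cE; have mEF := measurableI _ _ mE mF.
have [F0|F0] := eqVneq (P F) 0%E.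
  rewrite (_ : _%:E = P F); last by rewrite F0 mulr0.
  apply/eqP; rewrite eq_le [in X in _ && X]F0 measure_ge0 andbT.
  by apply: le_measure; rewrite ?inE //; exact: subIsetr.
rewrite -(cE F0) /condPr divfK ?fineK ?fin_num_measure //.
by rewrite fine_eq0 ?fin_num_measure.
Qed.

Lemma prob_split_state k (E : set T) : measurable E ->
  P E = (\sum_(a < N) P (E `&` [set w | Y k w = a]))%E.
Proof.
move=> mE; rewrite -(measure_bigsetU_ord P xpredT) //.
- rewrite -(bigcup_seq (index_enum 'I_N) (fun a => E `&` [set w | Y k w = a])).
  congr (P _); apply/seteqP; split => w /=; last by case=> a _ [].
  by move=> Ew; exists (Y k w) => //=; exact: mem_index_enum.
- by move=> a; apply: measurableI => //; exact: measurable_state.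
- by move=> a b _ _ [w [[_ /= <-] [_ /= <-]]].
Qed.

Lemma prob_state k a : P [set w | Y k w = a] = (mu 0 a)%:E.
Proof.
elim: k a => [|k IH] b; first exact: chain_stationary chain b.
rewrite (prob_split_state k); last exact: measurable_state.
transitivity (\sum_(a < N) (A a b * mu 0 a)%:E)%E.
  apply: eq_bigr => a _; rewrite (@condPr_prod _ _ (A a b)) ?IH //.
  - exact: measurable_state.
  - exact: measurable_state.
  - by move=> nz; apply: (chain_transition chain); rewrite IH.
rewrite sumEFin; congr EFin.
under eq_bigr => a _ do rewrite mulrC A_rev.
by rewrite -mulr_sumr A_stoch.2 mulr1.
Qed.

Lemma expectation_state (f : 'I_N -> R) k :
  ('E_P[fun w => f (Y k w)] = (mean mu f)%:E)%E.
Proof.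
rewrite unlock; pose S a := [set w | Y k w = a].
transitivity (\int[P]_w (\sum_(a < N) (f a)%:E * (\1_(S a) w)%:E))%E.
  apply: eq_integral => w _; rewrite (bigD1 (Y k w)) //= big1 ?addr0.
    by rewrite indicE mem_set // mule1.
  move=> a aY; rewrite indicE memNset ?mule0 // => /= e.
  by rewrite e eqxx in aY.
have mS a : measurable (S a) by exact: measurable_state.
have iS a : P.-integrable setT (fun w => (\1_(S a) w)%:E) by exact: integrable_indic.
rewrite integral_sum //; last by move=> a; exact: integrableZl.
rewrite /mean -sumEFin; apply: eq_bigr => a _.
rewrite integralZl // integral_indic // setIT.
by rewrite /S [X in (_ * X)%E](prob_state k a) -EFinM mulrC.
Qed.

Fixpoint path_weight a s : R :=
  if s is b :: s' then A a b * path_weight b s' else 1.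

Lemma path_weight_rcons a s b :
  path_weight a (rcons s b) = path_weight a s * A (last a s) b.
Proof. by elim: s a => [|c s IH] a /=; rewrite ?mulr1 ?mul1r // IH mulrA. Qed.

Definition past (s : nat -> 'I_N) k := [set w | forall j, (j <= k)%N -> Y j w = s j].

Lemma past0 s : past s 0 = [set w | Y 0%N w = s 0%N].
Proof.
apply/seteqP; split => w /= => [/(_ 0%N)->//|e j].
by rewrite leqn0 => /eqP ->.
Qed.

Lemma pastS s k : past s k.+1 = [set w | Y k.+1 w = s k.+1] `&` past s k.
Proof.
apply/seteqP; split => w /=.
  by move=> h; split => [|j jk]; apply: h => //; exact: leqW.
by move=> [e h] j; rewrite leq_eqVlt ltnS => /orP[/eqP->//|/h].
Qed.

Lemma measurable_past s k : measurable (past s k).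
Proof.
elim: k => [|k IH]; first by rewrite past0; exact: measurable_state.
by rewrite pastS; apply: measurableI => //; exact: measurable_state.
Qed.

(** The chain started at [mu] before time zero has the same law as the chain
started at [mu] at time zero, by stationarity; this is why the weight of the
first transition is averaged over [mu]. *)
Lemma prob_past s k :
  P (past s k) = (mean mu (path_weight^~ (mkseq s k.+1)))%:E.
Proof.
elim: k => [|k IH].
  have pick_s x : \sum_a x a * (a == s 0%N)%:R = x (s 0%N) :> R.
    rewrite (bigD1 (s 0%N)) //= eqxx mulr1 big1 ?addr0 //.
    by move=> a /negPf ->; rewrite mulr0.
  rewrite past0 prob_state -[mu 0 _](pick_s (mu 0)).
  rewrite -/(mean mu (fun a => (a == s 0%N)%:R)) -(mean_transition A_stoch A_rev).
  congr EFin; apply: eq_bigr => a _.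
  by rewrite /transition [X in _ * X]pick_s /= mulr1.
rewrite pastS (@condPr_prod _ _ (A (s k) (s k.+1))).
- rewrite IH; congr EFin; rewrite [fine _]/(mean _ _) /mean mulr_sumr.
  apply: eq_bigr => a _; rewrite [mkseq s k.+2]mkseqS path_weight_rcons.
  have -> : last a (mkseq s k.+1) = s k by rewrite mkseqS last_rcons.
  by ring.
- exact: measurable_state.
- exact: measurable_past.
- move=> nz; rewrite (chain_markov chain _ nz).
  apply: (chain_transition chain); apply: contra_neq nz => h.
  apply/eqP; rewrite eq_le measure_ge0 andbT -h.
  apply: le_measure; rewrite ?inE; [exact: measurable_past|exact: measurable_state|].
  by move=> w; apply.
Qed.

Lemma traj_past (s : nat -> 'I_N) n :
  [set w | traj Y n.+1 w = mkseq s n.+1] = past s n.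
Proof.
apply/seteqP; split => w /=.
  move=> e j jn; have := congr1 (fun t => nth (s j) t j) e.
  by rewrite !nth_mkseq.
move=> h; apply: (@eq_from_nth _ (s 0%N)) => [|i]; rewrite !size_mkseq // => i_n.
by rewrite !nth_mkseq // h.
Qed.

Lemma traj_event n s : size s = n.+1 ->
  measurable [set w | traj Y n.+1 w = s] /\
  P [set w | traj Y n.+1 w = s] = (mean mu (path_weight^~ s))%:E.
Proof.
case: s => // b s [<-].
have -> : b :: s = mkseq (nth b (b :: s)) (size s).+1.
  by rewrite -[(size s).+1]/(size (b :: s)) mkseq_nth.
by rewrite traj_past; split; [exact: measurable_past|exact: prob_past].
Qed.

Fixpoint words n : seq (seq 'I_N) :=
  if n is m.+1 then [seq b :: s | b <- enum 'I_N, s <- words m] else [:: [::]].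

Lemma mem_words n s : (s \in words n) = (size s == n).
Proof.
elim: n s => [|n IH] s; first by rewrite inE; case: s.
apply/allpairsP/eqP => [[[b t] /= [_ + ->]]|].
  by rewrite IH => /eqP <-.
case: s => // b s [sn]; exists (b, s); split => //=; first by rewrite mem_enum.
by rewrite IH sn.
Qed.

Lemma path_exp_words n F a :
  path_exp A n F a = \sum_(s <- words n) path_weight a s * F s.
Proof.
elim: n F a => [|n IH] F a /=; first by rewrite big_seq1 mul1r.
rewrite /transition big_allpairs_dep big_enum /=; apply: eq_bigr => b _.
by rewrite IH mulr_sumr; apply: eq_bigr => s _; rewrite mulrA.
Qed.

(** The event is a finite union of the events that the trajectory is a given
word, whose probabilities are known; subadditivity bounds it. *)
Lemma prob_traj_le n (Q : pred (seq 'I_N)) :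
  measurable [set w | Q (traj Y n.+1 w)] /\
  (P [set w | Q (traj Y n.+1 w)] <=
   (mean mu (path_exp A n.+1 (fun s => (Q s)%:R)))%:E)%E.
Proof.
pose E L := [set w | has (fun s => Q s && (traj Y n.+1 w == s)) L].
have EL L : {subset L <= words n.+1} -> measurable (E L) /\
   (P (E L) <= (\sum_(s <- L) (Q s)%:R * mean mu (path_weight^~ s))%:E)%E.
  elim: L => [|s L IH] Lw.
    have -> : E [::] = set0 by apply/seteqP; split.
    by rewrite measure0 big_nil.
  have [|mL PL] := IH; first by move=> t tL; apply: Lw; rewrite inE tL orbT.
  have [|ms Ps] := @traj_event n s; first by apply/eqP; rewrite -mem_words Lw ?inE ?eqxx.
  rewrite big_cons; have [Qs|Qs] := boolP (Q s); last first.
    have -> : E (s :: L) = E L by apply/seteqP; split => w; rewrite /E /= (negPf Qs).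
    by rewrite mul0r add0r.
  have -> : E (s :: L) = [set w | traj Y n.+1 w = s] `|` E L.
    apply/seteqP; split => w; rewrite /E /= Qs /=.
      by move=> /orP[/eqP|]; [left|right].
    by move=> [->|->]; rewrite ?eqxx ?orbT.
  split; first exact: measurableU.
  apply: (le_trans (measureU2 _ ms mL)).
  by rewrite EFinD mul1r; apply: leeD => //; rewrite -Ps; exact: lexx.
have [//|mE PE] := EL (words n.+1).
have QE : [set w | Q (traj Y n.+1 w)] = E (words n.+1).
  apply/seteqP; split => w; rewrite /E /=.
    move=> Qw; have : traj Y n.+1 w \in words n.+1 by rewrite mem_words size_mkseq.
    by move=> tw; apply/hasP; exists (traj Y n.+1 w); last by rewrite Qw eqxx.
  by move=> /hasP[s _ /andP[Qs /eqP ->]].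
rewrite QE; split => //; apply: (le_trans PE); rewrite lee_fin.
rewrite /mean; under eq_bigr => s _ do rewrite mulr_sumr.
rewrite exchange_big; apply: ler_sum => a _.
rewrite (path_exp_words n.+1) mulr_sumr; apply: ler_sum => s _.
by rewrite mulrCA [_%:R * _]mulrC.
Qed.

End ChainLaw.

(** * Small balls on the line *)

Section BinomialAverage.
Variable R : realType.

(** [C(k, b) / (b + 1) = C(k + 1, b + 1) / (k + 1)], so the sum is part of the
binomial expansion of [1] with exponent [k + 1]. *)
Lemma binomial_inv_le (p : R) k : 0 < p <= 1 ->
  \sum_(b < k.+1) 'C(k, b)%:R * ((1 - p) ^+ (k - b) * p ^+ b) / b.+1%:R <=
  (p * k.+1%:R)^-1.
Proof.
move=> /andP[p0 p1]; rewrite -[leRHS]mul1r ler_pdivlMr ?mulr_gt0 // mulr_suml.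
have one : 1 = \sum_(b < k.+2) (1 - p) ^+ (k.+1 - b) * p ^+ b *+ 'C(k.+1, b) :> R.
  by rewrite -exprDn subrK expr1n.
rewrite [leRHS]one [leRHS]big_ord_recl ler_wpDl //.
  by rewrite mulrn_wge0 // mulr_ge0 // exprn_ge0 ?subr_ge0 // ltW.
apply: ler_sum => b _; rewrite /= /bump /= add1n subSS.
have e : k.+1%:R * 'C(k, b)%:R = b.+1%:R * 'C(k.+1, b.+1)%:R :> R.
  by rewrite -!natrM mul_bin_diag.
rewrite -[leRHS]mulr_natl; rewrite le_eqVlt; apply/orP; left; apply/eqP.
have b0 : b.+1%:R != 0 :> R by [].
transitivity (k.+1%:R * 'C(k, b)%:R / b.+1%:R * (1 - p) ^+ (k - b) * (p * p ^+ b)).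
  by rewrite mulrACA; ring.
by rewrite e exprS -[b.+1%:R * _]mulrC mulfK // mulrA.
Qed.

(** The inverse first moment controls the inverse square root through
[1 / q <= (t / q ^ 2 + 1 / t) / 2], with [t] the square root of
[p (k + 1)]. *)
Lemma binomial_inv_sqrt_le (p : R) k : 0 < p <= 1 ->
  \sum_(b < k.+1) 'C(k, b)%:R * ((1 - p) ^+ (k - b) * p ^+ b) / Num.sqrt b.+1%:R <=
  (Num.sqrt (p * k.+1%:R))^-1.
Proof.
move=> p01; have /andP[p0 p1] := p01.
set t := Num.sqrt _; have t0 : 0 < t by rewrite sqrtr_gt0 mulr_gt0.
have t2 : p * k.+1%:R = t ^+ 2 by rewrite sqr_sqrtr // mulr_ge0 // ltW.
pose w (b : 'I_k.+1) := 'C(k, b)%:R * ((1 - p) ^+ (k - b) * p ^+ b).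
have w0 b : 0 <= w b by rewrite !mulr_ge0 // exprn_ge0 ?subr_ge0 // ltW.
have w1 : \sum_b w b = 1.
  rewrite -(expr1n _ k) -[in RHS](subrK p 1) exprDn; apply: eq_bigr => b _.
  by rewrite /w mulr_natl.
apply: (@le_trans _ _ (\sum_b (t / 2 * (w b / b.+1%:R) + w b / (2 * t)))).
  apply: ler_sum => b _; rewrite -/(w b).
  have c0 : 0 < b.+1%:R :> R by rewrite ltr0n.
  move: (b.+1%:R : R) c0 => c c0.
  have -> : t / 2 * (w b / c) + w b / (2 * t) = w b * ((t / c + t^-1) / 2).
    by field; rewrite !gt_eqF.
  apply: ler_wpM2l => //; set q := Num.sqrt _.
  have q0 : 0 < q by rewrite sqrtr_gt0.
  have -> : c = q ^+ 2 by rewrite sqr_sqrtr // ltW.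
  rewrite -subr_ge0.
  have -> : (t / q ^+ 2 + t^-1) / 2 - q^-1 = (t - q) ^+ 2 / (2 * t * q ^+ 2).
    by field; rewrite !gt_eqF.
  by rewrite divr_ge0 ?sqr_ge0 // !mulr_ge0 ?sqr_ge0 // ltW.
rewrite big_split /= -mulr_sumr -mulr_suml w1.
apply: (@le_trans _ _ (t / 2 * (t ^+ 2)^-1 + 1 / (2 * t))).
  rewrite lerD2r ler_wpM2l ?divr_ge0 ?(ltW t0) // -t2.
  exact: binomial_inv_le.
by rewrite le_eqVlt; apply/orP; left; apply/eqP; field; rewrite gt_eqF.
Qed.

(** The factors outside [G] are at most [1]; on [G] the inequality of means is
applied to the powers of order [#|G|] of the square roots, and the odd exponent
is rounded down. *)
Lemma geometric_arith_mean_le (I : finType) (G : {set I}) (g : I -> R) (v : R) :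
  (0 < #|G|)%N -> (forall i, 0 <= g i <= 1) -> v ^+ 2 <= \prod_i g i ->
  v <= (\sum_(i in G) g i ^+ #|G|./2) / #|G|%:R.
Proof.
set m := #|G| => m0 g01 vg.
have g0 i : 0 <= g i by case/andP: (g01 i).
have g1 i : g i <= 1 by case/andP: (g01 i).
pose h i := Num.sqrt (g i).
have h0 i : 0 <= h i by exact: sqrtr_ge0.
have h2 i : h i ^+ 2 = g i by rewrite sqr_sqrtr.
have h1 i : h i <= 1 by rewrite -(expr_le1 (n := 2)) // h2.
have vh : v <= \prod_(i in G) h i.
  apply: le_trans (ler_norm _) _.
  rewrite -(@ler_pXn2r _ 2) ?nnegrE ?prodr_ge0 // real_normK ?num_real //.
  rewrite -prodrXl (eq_bigr g) => [|i _]; last exact: h2.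
  apply: (le_trans vg); rewrite [leLHS](bigID (mem G)) /=.
  rewrite ler_piMr ?prodr_ge0 //; apply: prodr_ile1 => i _; exact: g01.
apply: (le_trans vh).
apply: (@le_trans _ _ ((\sum_(i in G) h i ^+ m) / m%:R)).
  rewrite -(@ler_pXn2r _ m) // ?nnegrE ?prodr_ge0 //; last first.
    by rewrite divr_ge0 // sumr_ge0 // => i _; rewrite exprn_ge0.
  have hm0 : {in pred_of_set G, forall i, 0 <= h i ^+ m}.
    by move=> i _; rewrite exprn_ge0.
  by rewrite -prodrXl; have [] := leif_AGM hm0.
rewrite ler_wpM2r ?invr_ge0 //; apply: ler_sum => i _.
rewrite -h2 -exprM mul2n -{1}(odd_double_half m) exprD ler_piMl ?exprn_ge0 //.
by rewrite exprn_ile1.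
Qed.

End BinomialAverage.

Section OneDim.
Variables (R : realType).

(** Rounding the exponent down to an even one removes the absolute value and
costs the factor [sqrt 2]. *)
Lemma walk_abs_cos_le (k b : nat) (r a s : R) :
  0 < r -> 1 <= `|a| -> (0 < k)%N -> s ^+ 2 = (2 * k%:R * r ^+ 2)^-1 ->
  `|2 * s * a| * b%:R <= 1 / 2 ->
  (\sum_(y <- walk R k.*2) `|cos (s * y * a)| ^+ b) / 4 ^+ k <=
  Num.sqrt 2 * (1 + 4 * r) / Num.sqrt b.+1%:R.
Proof.
move=> r0 a1 k0 s2 sab.
have four0 : 0 < (4 ^+ k : R) by rewrite exprn_gt0.
apply: (@le_trans _ _ ((\sum_(y <- walk R k.*2) cos (s * y * a) ^+ b./2.*2) / 4 ^+ k)).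
  rewrite ler_pM2r ?invr_gt0 //; apply: ler_sum => y _.
  have -> : cos (s * y * a) ^+ b./2.*2 = `|cos (s * y * a)| ^+ b./2.*2.
    by rewrite -muln2 mulnC !exprM real_normK ?num_real.
  rewrite -{1}(odd_double_half b) exprD ler_piMl ?exprn_ge0 //.
  by rewrite exprn_ile1 // cos_max.
have bh : (b./2 <= b)%N by rewrite -{2}(odd_double_half b); lia.
apply: (le_trans (walk_cos_even_le r0 a1 k0 s2 _)).
  by apply: le_trans sab; rewrite ler_wpM2l // ler_nat.
rewrite [Num.sqrt 2 * _]mulrC -mulrA ler_wpM2l //.
  by rewrite addr_ge0 // mulr_ge0 // ltW.
rewrite -[leLHS]mul1r ler_pdivrMr ?sqrtr_gt0 // mulrAC ler_pdivlMr ?sqrtr_gt0 // mul1r.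
rewrite -sqrtrM // ler_wsqrtr // -natrM ler_nat.
by rewrite -{1}(odd_double_half b); case: (odd b); lia.
Qed.

(** A power of the damping factor is the mean of [|cos| ^ B] for a binomial
variable [B] with parameter [(1 - lam) ^ 2]. *)
Lemma walk_damping_le (lam : R) (k K : nat) (r a s : R) :
  0 <= lam < 1 ->
  0 < r -> 1 <= `|a| -> (0 < k)%N -> s ^+ 2 = (2 * k%:R * r ^+ 2)^-1 ->
  `|2 * s * a| * K%:R <= 1 / 2 ->
  (\sum_(y <- walk R k.*2) damping lam (cos (s * y * a)) ^+ K) / 4 ^+ k <=
  Num.sqrt 2 * (1 + 4 * r) / ((1 - lam) * Num.sqrt K.+1%:R).
Proof.
move=> /andP[l0 l1] r0 a1 k0 s2 saK.
set p := (1 - lam) ^+ 2.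
have q0 : 0 < 1 - lam by rewrite subr_gt0.
have p0 : 0 < p by rewrite exprn_gt0.
have p1 : p <= 1 by rewrite expr_le1 ?(ltW q0) // gerBl.
have -> : (\sum_(y <- walk R k.*2) damping lam (cos (s * y * a)) ^+ K) / 4 ^+ k =
    \sum_(b < K.+1) 'C(K, b)%:R * ((1 - p) ^+ (K - b) * p ^+ b) *
      ((\sum_(y <- walk R k.*2) `|cos (s * y * a)| ^+ b) / 4 ^+ k).
  rewrite [RHS](eq_bigr (fun b : 'I_K.+1 => (\sum_(y <- walk R k.*2)
    'C(K, b)%:R * ((1 - p) ^+ (K - b) * p ^+ b) * `|cos (s * y * a)| ^+ b) / 4 ^+ k)); last first.
    by move=> b _; rewrite -mulr_sumr [LHS]mulrA.
  rewrite -mulr_suml exchange_big /=; congr (_ / _); apply: eq_bigr => y _.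
  rewrite /damping -/p exprDn; apply: eq_bigr => b _.
  by rewrite exprMn -[LHS]mulr_natl !mulrA.
apply: (@le_trans _ _ (\sum_(b < K.+1) Num.sqrt 2 * (1 + 4 * r) *
    ('C(K, b)%:R * ((1 - p) ^+ (K - b) * p ^+ b) / Num.sqrt b.+1%:R))).
  apply: ler_sum => b _; rewrite [leRHS]mulrCA; apply: ler_wpM2l.
    by rewrite !mulr_ge0 // exprn_ge0 ?subr_ge0 // ltW.
  apply: walk_abs_cos_le => //; apply: le_trans saK.
  by rewrite ler_wpM2l // ler_nat -ltnS.
rewrite -mulr_sumr; apply: ler_wpM2l.
  by rewrite mulr_ge0 // ?sqrtr_ge0 // addr_ge0 // mulr_ge0 // ltW.
have -> : (1 - lam) * Num.sqrt K.+1%:R = Num.sqrt (p * K.+1%:R).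
  by rewrite sqrtrM ?(ltW p0) // sqrtr_sqr ger0_norm // ltW.
by apply: binomial_inv_sqrt_le; rewrite p0.
Qed.

Variables (N : nat) (mu : 'rV[R]_N) (A : 'M[R]_N).
Hypothesis mu_prob : prob_vector mu.
Hypothesis A_stoch : stochastic A.
Hypothesis A_rev : reversible mu A.
Variable lam : R.
Hypothesis lam_itv : 0 <= lam < 1.
Hypothesis A_contr : contracts mu A lam.

Lemma phase_scale (xi : R) (hs : seq ('I_N -> R)) s :
  phase [seq (fun b => xi * h b) | h <- hs] s = xi * phase hs s.
Proof.
elim: hs s => [|h hs IH] [|b s] /=; rewrite ?mulr0 //.
by rewrite IH mulrDr.
Qed.

Lemma sign_sin (e t : R) : e = -1 \/ e = 1 -> sin (t * e) = sin t * e.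
Proof. by case=> ->; rewrite ?mulr1 // mulrN1 sinN mulrN1. Qed.

Lemma sign_cos (e t : R) : e = -1 \/ e = 1 -> cos (t * e) = cos t.
Proof. by case=> ->; rewrite ?mulr1 // mulrN1 cosN. Qed.

(** The scale [s] of the frequency walk is fixed by [2 k s^2 r^2 = 1], so that
the kernel [cos (s t) ^ 2k] is at least [1/2] when [|t| <= r].  Its length [2k]
is then taken so large that [s |a_i| K <= 1/4], where [K = #|G|./2] bounds the
length of the second walk, which therefore stays within one period. *)
Lemma small_ball_signed_sum n (a : 'I_n -> R) (f : 'I_n -> 'I_N -> R)
    (G : {set 'I_n}) (x0 r : R) :
  (forall i b, f i b = -1 \/ f i b = 1) -> (forall i, mean mu (f i) = 0) ->
  (0 < #|G|)%N -> (forall i, i \in G -> 1 <= `|a i|) -> 0 < r ->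
  mean mu (path_exp A n (fun s =>
    (`|phase [seq (fun b => a i * f i b) | i <- enum 'I_n] s - x0| <= r)%R%:R)) <=
  2 * (Num.sqrt 2 * (1 + 4 * r)) / ((1 - lam) * Num.sqrt #|G|./2.+1%:R).
Proof.
move=> f_sign f_mean G0 aG r0; set hs := [seq _ | i <- _].
have [l0 l1] : 0 <= lam /\ lam < 1 by case/andP: lam_itv.
set K := #|G|./2.
pose B := \sum_i `|a i|.
have aB i : `|a i| <= B by rewrite /B (bigD1 i) //= lerDl sumr_ge0.
have B0 : 0 <= B by exact: sumr_ge0.
pose k := Num.bound ((4 * B * K%:R / r) ^+ 2).
have kB : (4 * B * K%:R / r) ^+ 2 < k%:R by rewrite archi_boundP // sqr_ge0.
have k0 : (0 < k)%N by rewrite -(ltr0n R); apply: le_lt_trans kB; rewrite sqr_ge0.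
have k0R : 0 < (k%:R : R) by rewrite ltr0n.
pose s := (Num.sqrt (2 * k%:R) * r)^-1.
have s0 : 0 < s by rewrite invr_gt0 mulr_gt0 // sqrtr_gt0 mulr_gt0.
have s2 : s ^+ 2 = (2 * k%:R * r ^+ 2)^-1.
  by rewrite exprVn exprMn sqr_sqrtr // mulr_ge0.
have sa i : `|2 * s * a i| * K%:R <= 1 / 2.
  have BKs : 4 * B * K%:R * s <= 1.
    have -> : 4 * B * K%:R * s = 4 * B * K%:R / r * (s * r) by field; rewrite gt_eqF.
    have pos : 0 <= 4 * B * K%:R / r by rewrite divr_ge0 ?mulr_ge0 ?(ltW r0).
    have sr0 : 0 <= s * r by rewrite mulr_ge0 // ltW.
    rewrite -(expr_le1 (n := 2)) //; last by rewrite mulr_ge0.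
    rewrite exprMn [(s * r) ^+ 2]exprMn s2 invfM mulfVK; last by rewrite gt_eqF ?exprn_gt0.
    by rewrite ler_pdivrMr ?mulr_gt0 // mul1r; apply: (le_trans (ltW kB)); lra.
  rewrite !normrM (gtr0_norm s0) normr_nat.
  have : `|a i| * (s * K%:R) <= B * (s * K%:R) by rewrite ler_wpM2r // mulr_ge0 // ltW.
  by lra.
have c40 : 0 < (4 ^+ k : R) by rewrite exprn_gt0.
pose Phi y := mean mu (path_exp A n (fun t => cos (s * (phase hs t - x0) * y))).
have step1 : mean mu (path_exp A n (fun t => (`|phase hs t - x0| <= r)%R%:R)) <=
    2 / 4 ^+ k * \sum_(y <- walk R k.*2) Phi y.
  rewrite /Phi /mean exchange_big mulr_sumr; apply: ler_sum => b _.
  rewrite -mulr_sumr mulrCA; apply: ler_wpM2l; first exact: mu_prob.1.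
  rewrite -path_exp_sum -[leRHS]addr0.
  rewrite -[X in _ + X](mul0r (path_exp A n (fun=> 0) b)) -path_exp_lin.
  apply: le_path_exp => // t; rewrite mul0r addr0.
  have := sum_walk_cos k.*2 (s * (phase hs t - x0)) 0.
  under eq_bigr => y _ do rewrite addr0.
  move=> ->; rewrite cos0 mulr1 exprMn.
  have -> : (2 : R) ^+ k.*2 = 4 ^+ k by rewrite -muln2 mulnC exprM -natrX.
  rewrite mulrA mulfVK ?gt_eqF //.
  have [tr|_] := leP `|phase hs t - x0| r; last first.
    by rewrite mulr_ge0 // cos_expn_double exprn_ge0 // subr_ge0;
      case/andP: (sqr_sin_itv (s * (phase hs t - x0))).
  rewrite -ler_pdivrMl // mulr1 -[2^-1]mul1r; apply: cos_expn_ge.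
  rewrite exprMn s2 -[(_ - x0) ^+ 2]real_normK ?num_real //.
  apply: (@le_trans _ _ (k%:R * ((2 * k%:R * r ^+ 2)^-1 * r ^+ 2))).
    apply: ler_wpM2l => //; apply: ler_wpM2l.
      by rewrite invr_ge0 mulr_ge0 ?sqr_ge0 // mulr_ge0.
    by rewrite lerXn2r ?nnegrE // ltW.
  by rewrite le_eqVlt; apply/orP; left; apply/eqP; field; rewrite !gt_eqF.
have step2 y : Phi y <=
    (\sum_(i in G) damping lam (cos (s * y * a i)) ^+ K) / #|G|%:R.
  apply: (@geometric_arith_mean_le _ _ G (fun i => damping lam (cos (s * y * a i)))) => //.
    by move=> i; apply: damping_itv; [rewrite l0 ltW|exact: cos_max].
  pose ths := [seq (fun b => s * y * h b) | h <- hs].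
  have size_ths : size ths = n by rewrite /ths /hs 2!size_map size_enum_ord.
  have -> : Phi y = mean mu (path_exp A (size ths) (fun t => cos (phase ths t - s * y * x0))).
    rewrite size_ths; congr mean; apply/funext => b; apply: eq_path_exp => t.
    by rewrite phase_scale -mulrBr; congr cos; ring.
  have l01 : 0 <= lam <= 1 by rewrite l0 ltW.
  have th_mean (g : R -> R) i :
      mean mu (g \o (fun b => s * y * (a i * f i b))) =
      \sum_b mu 0 b * g (s * y * a i * f i b).
    by apply: eq_bigr => b _; rewrite /= mulrA.
  apply: le_trans (sqr_mean_path_exp_cos_le mu_prob A_stoch A_rev l01 A_contr _ _) _.
    move=> th /mapP[h /mapP[i _ ->] ->]; rewrite th_mean.
    under eq_bigr => b _ do rewrite sign_sin // mulrCA.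
    by rewrite -mulr_sumr [X in _ * X]f_mean mulr0.
  rewrite 2!big_map big_enum /=; apply: ler_prod => i _.
  rewrite th_mean; under eq_bigr => b _ do rewrite sign_cos //.
  rewrite -mulr_suml mu_prob.2 mul1r lexx andbT.
  by case/andP: (damping_itv l01 (cos_max (s * y * a i))).
apply: (le_trans step1).
set Z := Num.sqrt 2 * _; set W := _ * Num.sqrt _.
rewrite -mulrA -mulrA ler_pM2l // mulrC.
apply: (@le_trans _ _ ((\sum_(y <- walk R k.*2)
   (\sum_(i in G) damping lam (cos (s * y * a i)) ^+ K) / #|G|%:R) / 4 ^+ k)).
  by rewrite ler_pM2r ?invr_gt0 //; apply: ler_sum => y _; exact: step2.
rewrite -mulr_suml exchange_big mulrAC ler_pdivrMr ?ltr0n //.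
rewrite mulr_suml; apply: (@le_trans _ _ (\sum_(i in G) Z / W)).
  by apply: ler_sum => i iG; apply: walk_damping_le => //; exact: aG.
by rewrite sumr_const mulr_natr.
Qed.

End OneDim.

(** * Projection along random signs *)

Section RandomSigns.
Variable R : realType.

Definition cons_sign d (x : R) (e : {ffun 'I_d -> R}) : {ffun 'I_d.+1 -> R} :=
  [ffun i => if unlift ord0 i is Some j then e j else x].

(** All sign vectors; a list, like [walk], for the sake of induction on the
dimension. *)
Fixpoint signs d : seq {ffun 'I_d -> R} :=
  if d is d'.+1 then
    [seq cons_sign 1 e | e <- signs d'] ++ [seq cons_sign (-1) e | e <- signs d']
  else [:: [ffun=> 0]].

Definition dot d (v e : 'I_d -> R) : R := \sum_i v i * e i.

Lemma size_signs d : size (signs d) = (2 ^ d)%N.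
Proof. by elim: d => // d IH; rewrite /= size_cat !size_map IH expnS mul2n addnn. Qed.

Lemma sqr_sign d e i : e \in signs d -> e i ^+ 2 = 1.
Proof.
elim: d e i => [|d IH] e i; first by case: i.
rewrite mem_cat => /orP[] /mapP[e' e'd ->]; rewrite ffunE;
  by case: unliftP => [j _|_]; rewrite ?IH // ?sqrrN expr1n.
Qed.

Lemma dot_cons d (v : 'I_d.+1 -> R) x e :
  dot v (cons_sign x e) = v ord0 * x + dot (v \o lift ord0) e.
Proof.
rewrite /dot big_ord_recl ffunE unlift_none; congr (_ + _).
by apply: eq_bigr => i _; rewrite ffunE liftK.
Qed.

Lemma sum_signsS d (F : {ffun 'I_d.+1 -> R} -> R) :
  \sum_(e <- signs d.+1) F e =
  \sum_(e <- signs d) F (cons_sign 1 e) + \sum_(e <- signs d) F (cons_sign (-1) e).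
Proof. by rewrite /= big_cat !big_map. Qed.

Definition sqr_len d (v : 'I_d -> R) : R := \sum_i v i ^+ 2.

Lemma sqr_len_ge0 d (v : 'I_d -> R) : 0 <= sqr_len v.
Proof. by apply: sumr_ge0 => i _; exact: sqr_ge0. Qed.

Lemma sqr_len_recl d (v : 'I_d.+1 -> R) :
  sqr_len v = v ord0 ^+ 2 + sqr_len (v \o lift ord0).
Proof. by rewrite /sqr_len big_ord_recl. Qed.

Lemma signs_moment2 d (v : 'I_d -> R) y :
  \sum_(e <- signs d) (y + dot v e) ^+ 2 = 2 ^+ d * (y ^+ 2 + sqr_len v).
Proof.
elim: d v y => [|d IH] v y; first by rewrite big_seq1 /dot /sqr_len !big_ord0; ring.
rewrite sum_signsS.
under eq_bigr => e _ do rewrite dot_cons addrA.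
under [X in _ + X]eq_bigr => e _ do rewrite dot_cons addrA.
by rewrite !IH sqr_len_recl (exprS 2 d); ring.
Qed.

Lemma signs_moment4 d (v : 'I_d -> R) y :
  \sum_(e <- signs d) (y + dot v e) ^+ 4 <=
  2 ^+ d * (y ^+ 4 + 6 * y ^+ 2 * sqr_len v + 3 * sqr_len v ^+ 2).
Proof.
elim: d v y => [|d IH] v y.
  by rewrite big_seq1 /dot /sqr_len !big_ord0 !mulr0 expr0n mulr0 !addr0 mul1r.
rewrite sum_signsS.
under eq_bigr => e _ do rewrite dot_cons addrA.
under [X in _ + X]eq_bigr => e _ do rewrite dot_cons addrA.
apply: (le_trans (lerD (IH _ _) (IH _ _))).
rewrite sqr_len_recl -mulrDr [2 ^+ d.+1]exprSr -[leRHS]mulrA.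
apply: ler_wpM2l; first by rewrite exprn_ge0.
move: (v ord0) (sqr_len _) => w q.
have : 0 <= (w ^+ 2) ^+ 2 by exact: sqr_ge0.
by lra.
Qed.

(** A second-moment argument: for [t = <v, e>^2 / |v|^2] the indicator of
[t >= 1/4] dominates [(t - 1/4) (33/4 - t) / 16], which is negative below [1/4]
and has maximum [1]; its mean is at least [55/256 > 1/5] as [t] has mean [1]
and second moment at most [3]. *)
Lemma many_large_projections d (v : 'I_d -> R) : 1 <= sqr_len v ->
  2 ^+ d / 5 <= \sum_(e <- signs d) (1 <= `|2 * dot v e|)%R%:R :> R.
Proof.
set q := sqr_len v => v1; have q0 : 0 < q by exact: lt_le_trans v1.
pose t e := dot v e ^+ 2 / q.
apply: (@le_trans _ _ (\sum_(e <- signs d) (t e - 1 / 4) * (33 / 4 - t e) / 16)).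
  have m2 : \sum_(e <- signs d) t e = 2 ^+ d.
    have := signs_moment2 v 0; rewrite /t -mulr_suml expr0n add0r.
    under eq_bigr => e _ do rewrite add0r.
    by move=> ->; rewrite mulfK // gt_eqF.
  have m4 : \sum_(e <- signs d) t e ^+ 2 <= 3 * 2 ^+ d.
    have := signs_moment4 v 0; rewrite !expr0n /= mulr0 mul0r !add0r.
    under eq_bigr => e _ do rewrite add0r.
    rewrite /t; under [X in _ -> X <= _]eq_bigr => e _ do rewrite expr_div_n -exprM.
    by rewrite -mulr_suml ler_pdivrMr ?exprn_gt0 // -/q; lra.
  have m0 : \sum_(e <- signs d) (1 : R) = 2 ^+ d.
    by rewrite big_const_seq count_predT size_signs iter_addr_0 natrX.
  have -> : \sum_(e <- signs d) (t e - 1 / 4) * (33 / 4 - t e) / 16 =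
    (17 / 32) * (\sum_(e <- signs d) t e) - (1 / 16) * (\sum_(e <- signs d) t e ^+ 2)
     - (33 / 256) * \sum_(e <- signs d) 1.
    by rewrite !mulr_sumr -!sumrB; apply: eq_bigr => e _; field.
  rewrite m2 m0; have : 0 < (2 : R) ^+ d by rewrite exprn_gt0.
  by lra.
apply: ler_sum => e _; have [h|h] := leP 1 `|2 * dot v e|.
  by have := sqr_ge0 (t e - 17 / 4); rewrite /=; lra.
have t0 : 0 <= t e by rewrite divr_ge0 ?sqr_ge0 // ltW.
have t4 : t e < 1 / 4.
  have : `|2 * dot v e| ^+ 2 < 1 by rewrite expr_lt1.
  rewrite real_normK ?num_real // exprMn => z4.
  by rewrite ltr_pdivrMr //; lra.
have : 0 <= (1 / 4 - t e) * (33 / 4 - t e) by rewrite mulr_ge0 //; lra.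
by rewrite /= mulr0n; lra.
Qed.

Lemma exists_ge_average (T : eqType) (L : seq T) (F : T -> R) c :
  (0 < size L)%N -> c * (size L)%:R <= \sum_(e <- L) F e ->
  exists2 e, e \in L & c <= F e.
Proof.
elim: L => // e L IH _ /=; rewrite big_cons -natr1 mulrDr mulr1 => h.
have [ce|ec] := leP c (F e); first by exists e; rewrite ?inE ?eqxx.
case: L IH h => [|e' L] IH h.
  by move: h; rewrite big_nil mulr0 add0r addr0 leNgt ec.
have [//||x xL cx] := IH; first by lra.
by exists x; rewrite // inE xL orbT.
Qed.

(** The average over the signs of the number of good indices is at least
[n / 5]. *)
Lemma good_signs n d (v : 'I_n -> 'I_d -> R) : (forall i, 1 <= sqr_len (v i)) ->
  exists2 e, e \in signs d &
    n%:R <= 5 * #|[set i | 1 <= `|2 * dot (v i) e|]%SET|%:R :> R.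
Proof.
move=> v1.
pose F (e : {ffun 'I_d -> R}) : R := \sum_i (1 <= `|2 * dot (v i) e|)%R%:R.
have [||e ed Fe] := @exists_ge_average _ (signs d) F (n%:R / 5).
- by rewrite size_signs expn_gt0.
- rewrite size_signs exchange_big /= natrX.
  apply: (@le_trans _ _ (\sum_(i < n) 2 ^+ d / 5)).
    by rewrite sumr_const card_ord -[leRHS]mulr_natl mulrAC mulrA.
  by apply: ler_sum => i _; exact: many_large_projections.
exists e => //; move: Fe; rewrite ler_pdivrMr // mulrC /F -natr_sum.
by rewrite -big_mkcond sum1dep_card.
Qed.

Lemma sqr_dot_sign_le d (x : 'I_d -> R) e : e \in signs d ->
  dot x e ^+ 2 <= d%:R * sqr_len x.
Proof.
move=> ed; case: d x e ed => [|d] x e ed.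
  by rewrite /dot big_ord0 expr0n mul0r.
have d0 : 0 < d.+1%:R :> R by rewrite ltr0n.
have := @jensen_sqr R 'I_d.+1 (fun=> d.+1%:R^-1) (fun i => x i * e i).
rewrite -!mulr_sumr -/(dot x e) exprMn.
have -> : \sum_i (x i * e i) ^+ 2 = sqr_len x.
  by apply: eq_bigr => i _; rewrite exprMn (sqr_sign i ed) mulr1.
rewrite sumr_const card_ord -[d.+1%:R^-1 *+ _]mulr_natr mulVf ?gt_eqF // invr_ge0.
move=> /(_ (fun=> ltW d0) erefl).
rewrite -(ler_pM2l (exprn_gt0 2 d0)) mulrA -exprMn divff ?gt_eqF // expr1n mul1r.
by rewrite mulrA [d.+1%:R ^+ 2]expr2 mulfK ?gt_eqF.
Qed.

End RandomSigns.

(** * The small-ball bound for vectors *)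

Lemma phase_map (R : realType) (N : nat) (I : Type) (l : seq I)
    (h : I -> 'I_N -> R) (y : I -> 'I_N) :
  phase [seq h i | i <- l] [seq y i | i <- l] = \sum_(i <- l) h i (y i).
Proof. by elim: l => [|i l IH]; rewrite ?big_nil // big_cons /= IH. Qed.

Lemma phase_traj (R : realType) (N n : nat) (T : Type) (Y : nat -> T -> 'I_N)
    (h : 'I_n -> 'I_N -> R) w :
  phase [seq h i | i <- enum 'I_n] (traj Y n w) = \sum_i h i (Y i w).
Proof.
rewrite /traj /mkseq -val_enum_ord -map_comp.
by rewrite (phase_map (enum 'I_n) h (fun i => Y i w)) big_enum.
Qed.

Lemma natr_half_ge (R : numDomainType) m : m%:R + 1 <= 2 * m./2.+1%:R :> R.
Proof.
by rewrite natr1 -natrM ler_nat -{1}(odd_double_half m); case: (odd m); lia.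
Qed.

(* The bound is an extended real: division there satisfies 0^-1 = +oo, so the
   right-hand side is +oo when the operator norm is 1. *)
Theorem theorem1p2 (R : realType) :
  exists C C' : R, 0 < C /\ 0 < C' /\
  forall (N n d : nat), (1 <= N)%N -> (1 <= n)%N -> (1 <= d)%N ->
  forall (dsp : measure_display) (T : measurableType dsp) (P : probability T R)
    (A : 'M[R]_N) (mu : 'rV[R]_N) (Y : nat -> T -> 'I_N),
  stationary_reversible_chain P A mu Y ->
  forall f : 'I_n -> 'I_N -> R,
  (forall i a, f i a = -1 \/ f i a = 1) ->
  (forall i : 'I_n, ('E_P[fun w => f i (Y i w)] = 0)%E) ->
  forall (x0 : 'rV[R]_d) (r : R), 1 / (C' * Num.sqrt d%:R) <= r ->
  forall v : 'I_n -> 'rV[R]_d, (forall i, 1 <= l2norm (v i)) ->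
  (P [set w | (l2norm (\sum_(i < n) f i (Y i w) *: v i - x0) <= r)%R] <=
    (C * r * Num.sqrt d%:R)%:E /
    ((1 - L2opnorm mu (A - averaging mu)) * Num.sqrt n%:R)%:E)%E.
Proof.
(* 90 = 2 * 9 * 5: the kernel is at least 1/2, 1 + 4 * (2 * rho) <= 9 * rho when
   rho >= 1, and sqrt 2 * sqrt n <= 5 * sqrt (m / 2 + 1) when n <= 5 m. *)
exists 90, 1; split => //; split => // N n d N1 n1 d1 dsp T P A mu Y chain f.
move=> f_sign f_exp x0 r; rewrite !mul1r => r_ge v v_ge1.
have mu_prob := chain_prob_vector chain.
have A_stoch := chain_stochastic chain.
have A_rev := chain_reversible chain.
set lam := L2opnorm _ _.
have lam_ge0 : 0 <= lam := L2opnorm_ge0 mu_prob A_stoch A_rev.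
have lam_le1 : lam <= 1 := L2opnorm_le1 mu_prob A_stoch A_rev.
have lam_contr : contracts mu A lam := L2opnorm_contracts mu_prob A_stoch A_rev.
have sd0 : 0 < Num.sqrt d%:R :> R by rewrite sqrtr_gt0 ltr0n.
have sn0 : 0 < Num.sqrt n%:R :> R by rewrite sqrtr_gt0 ltr0n.
(* The radius on the line is 2 * rho, the projections being doubled. *)
pose rho := r * Num.sqrt d%:R.
have rho1 : 1 <= rho by rewrite -ler_pdivrMr // mul1r.
rewrite -mulrA -/rho.
have [lam1|lam_neq1] := eqVneq lam 1.
  rewrite lam1 subrr mul0r inve0 gt0_muley ?leey // lte_fin mulr_gt0 //.
  exact: lt_le_trans ltr01 rho1.
have lam_lt1 : lam < 1 by rewrite lt_neqAle lam_neq1.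
have q0 : 0 < 1 - lam by rewrite subr_gt0.
rewrite inver gt_eqF ?mulr_gt0 // -EFinM.
have f_mean i : mean mu (f i) = 0.
  by have := f_exp i; rewrite (expectation_state chain) => -[].
have v_len i : 1 <= sqr_len (v i 0).
  rewrite -[1]sqr_sqrtr // sqrtr1.
  have := v_ge1 i; rewrite /l2norm -/(sqr_len (v i 0)) => v1.
  by rewrite -[leRHS]sqr_sqrtr ?sqr_len_ge0 // lerXn2r ?nnegrE // sqrtr_ge0.
have [e ed] := good_signs v_len; set G := [set i | _]%SET => G_large.
have G0 : (0 < #|G|)%N.
  have : 0 < n%:R :> R by rewrite ltr0n.
  by rewrite -(ltr0n R); lra.
pose a i := 2 * dot (v i 0) e; pose y0 := 2 * dot (x0 0) e.
pose hs := [seq (fun b => a i * f i b) | i <- enum 'I_n].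
have a_ge1 i : i \in G -> 1 <= `|a i| by rewrite inE.
have rho0 : 0 < 2 * rho by rewrite mulr_gt0 // (lt_le_trans _ rho1).
have small := @small_ball_signed_sum R N mu A mu_prob A_stoch A_rev lam
  (introT andP (conj lam_ge0 lam_lt1)) lam_contr n a f G y0 (2 * rho)
  f_sign f_mean G0 a_ge1 rho0.
have en : n = n.-1.+1 by rewrite prednK.
have event_meas : measurable
    [set w | l2norm (\sum_(i < n) f i (Y i w) *: v i - x0) <= r].
  (* The default state is never read: the trajectory has length n. *)
  pose Q s := l2norm (\sum_(i < n) f i (nth (Ordinal N1) s i) *: v i - x0) <= r.
  have [+ _] := prob_traj_le chain n.-1 Q; rewrite -en.
  have Q_traj w : Q (traj Y n w) = (l2norm (\sum_(i < n) f i (Y i w) *: v i - x0) <= r).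
    congr (l2norm (_ - x0) <= r); apply: eq_bigr => i _.
    by rewrite nth_mkseq.
  by congr measurable; apply/seteqP; split => w /=; rewrite Q_traj.
have [proj_meas proj_le] := prob_traj_le chain n.-1 (fun s => `|phase hs s - y0| <= 2 * rho).
rewrite -en in proj_meas proj_le.
apply: (@le_trans _ _ (P [set w | `|phase hs (traj Y n w) - y0| <= 2 * rho])).
  apply: le_measure; rewrite ?inE // => w /=.
  rewrite phase_traj; set x := _ - x0 => x_le.
  have -> : \sum_i a i * f i (Y i w) - y0 = 2 * dot (x 0) e.
    have dot_x : dot (x 0) e = \sum_i f i (Y i w) * dot (v i 0) e - dot (x0 0) e.
      rewrite /dot; under [in RHS]eq_bigr => i _ do rewrite mulr_sumr.
      rewrite exchange_big -sumrB; apply: eq_bigr => j _.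
      rewrite !mxE summxE mulrBl mulr_suml; congr (_ - _).
      by apply: eq_bigr => i _; rewrite mxE mulrA.
    rewrite dot_x mulrBr mulr_sumr; congr (_ - _).
    by apply: eq_bigr => i _; rewrite /a; ring.
  rewrite normrM normr_nat ler_pM2l //.
  rewrite -(@ler_pXn2r _ 2) ?nnegrE //; last exact: le_trans ler01 rho1.
  rewrite real_normK ?num_real //; apply: (le_trans (sqr_dot_sign_le _ ed)).
  rewrite /rho exprMn sqr_sqrtr // mulrC ler_wpM2r //.
  rewrite -[leLHS]sqr_sqrtr ?sqr_len_ge0 // lerXn2r ?nnegrE ?sqrtr_ge0 //.
  exact: le_trans (sqrtr_ge0 _) x_le.
apply: (le_trans proj_le); rewrite lee_fin; apply: (le_trans small).
set m := #|G| in G0 G_large *.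
have sm0 : 0 < Num.sqrt m./2.+1%:R :> R by rewrite sqrtr_gt0.
have half_m : m%:R + 1 <= 2 * m./2.+1%:R :> R by exact: natr_half_ge.
have sqrt_le : Num.sqrt 2 * Num.sqrt n%:R <= 5 * Num.sqrt m./2.+1%:R :> R.
  rewrite -sqrtrM // -[5](@ger0_norm R) // -sqrtr_sqr -sqrtrM ?sqr_ge0 //.
  by rewrite ler_wsqrtr //; have := ler0n R m; lra.
have -> : 90 * rho * ((1 - lam) * Num.sqrt n%:R)^-1 =
    90 * rho * Num.sqrt m./2.+1%:R / Num.sqrt n%:R /
    ((1 - lam) * Num.sqrt m./2.+1%:R).
  by field; rewrite !gt_eqF.
rewrite ler_pM2r ?invr_gt0 ?mulr_gt0 // ler_pdivlMr //.
have rho_lin : 1 + 4 * (2 * rho) <= 9 * rho by lra.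
apply: (@le_trans _ _ (2 * (9 * rho) * (Num.sqrt 2 * Num.sqrt n%:R))).
  rewrite (_ : 2 * (Num.sqrt 2 * _) * _ =
    2 * (1 + 4 * (2 * rho)) * (Num.sqrt 2 * Num.sqrt n%:R)); last by ring.
  by rewrite ler_wpM2r ?mulr_ge0 ?sqrtr_ge0 // ler_pM2l.
rewrite (_ : 90 * rho * _ = 2 * (9 * rho) * (5 * Num.sqrt m./2.+1%:R)); last by ring.
by rewrite ler_wpM2l //; lra.
Qed.
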